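(* Let $G$ be a Warfield group. Then $G$ is generalized Bassian if, and only if, it is a B+E-group.
   Context: All groups are abelian. A group is simply presented if it can be defined by generators and relations in which every relation has the form $px=y$ or $px=0$, where $p$ is a prime and $x,y$ are generators. A Warfield group is a group isomorphic to a direct summand of a simply presented group. A group $G$ is Bassian (respectively, generalized Bassian) if, for every subgroup $N$ of $G$, the existence of an injective homomorphism $G\to G/N$ implies that $N=\{0\}$ (respectively, that $N$ is a direct summand of $G$). A torsion group $E$ is elementary if, for every prime $p$, its $p$-primary component $E_p$ satisfies $pE_p=0$. A group $G$ is a B+E-group if it decomposes as $G=A\oplus E$, where $A$ is Bassian and $E$ is elementary. *)

(* Defs.v *)
(* An abelian group is a zmodType.  A subgroup of G is a [zmodClosed G]: its
   membership test is boolean, but as boolp turns every Prop-valued predicate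
   into a boolean one, all subgroups are covered.  All quotients are those of
   ring_quotient, written [Quotient.quot N]. *)
From HB Require Import structures.
From mathcomp Require Import all_boot all_algebra.
From mathcomp Require Import boolp.
From mathcomp Require Import freeg.

Set Implicit Arguments.
Unset Strict Implicit.
Unset Printing Implicit Defensive.

Import GRing.Theory.
Local Open Scope ring_scope.

Definition isomorphic (G H : zmodType) : Prop :=
  exists f : {additive G -> H}, bijective f.

Section SubgroupType.
Variables (G : zmodType) (N : zmodClosed G).

Record subgroup_type := SubgroupElt {
  subgroup_val :> G;
  subgroup_valP : subgroup_val \in N
}.

HB.instance Definition _ := [isSub for subgroup_val].
HB.instance Definition _ := [Choice of subgroup_type by <:].
HB.instance Definition _ := [SubChoice_isSubZmodule of subgroup_type by <:].

End SubgroupType.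

Section Generated.
Variables (G : zmodType) (R : G -> Prop).

Definition generated : {pred G} := fun u =>
  `[< forall N : zmodClosed G, (forall r, R r -> r \in N) -> u \in N >].

Fact generated_zmod_closed : zmod_closed generated.
Proof.
split=> [|u v].
  by apply/asboolP => N _; exact: rpred0.
move=> /asboolP uP /asboolP vP; apply/asboolP => N RN.
by rewrite rpredB ?uP ?vP.
Qed.

HB.instance Definition _ :=
  GRing.isZmodClosed.Build G generated generated_zmod_closed.

End Generated.

Definition direct_sum (G : zmodType) (N M : zmodClosed G) : Prop :=
  (forall x : G, exists n m : G, [/\ n \in N, m \in M & x = n + m]) /\
  (forall x : G, x \in N -> x \in M -> x = 0).

Definition direct_summand (G : zmodType) (N : zmodClosed G) : Prop :=
  exists M : zmodClosed G, direct_sum N M.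

(* A relation p x = 0 or p x = y between generators is encoded by its relator
   in the free abelian group {freeg X}; y = x is allowed. *)
Definition simple_relator (X : choiceType) (u : {freeg X}) : Prop :=
  exists (p : nat) (x : X), prime p /\
    (u = << x >> *+ p \/ exists y : X, u = << x >> *+ p - << y >>).

Definition simply_presented (G : zmodType) : Prop :=
  exists (X : choiceType) (R : {freeg X} -> Prop),
    (forall u, R u -> simple_relator u) /\
    isomorphic G (Quotient.quot (generated R)).

Definition warfield (G : zmodType) : Prop :=
  exists (H : zmodType) (N : zmodClosed H),
    [/\ simply_presented H, direct_summand N & isomorphic G (subgroup_type N)].

Definition embeds (G H : zmodType) : Prop :=
  exists f : {additive G -> H}, injective f.

Definition bassian (G : zmodType) : Prop :=
  forall N : zmodClosed G, embeds G (Quotient.quot N) -> N =i pred1 0.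

Definition generalized_bassian (G : zmodType) : Prop :=
  forall N : zmodClosed G, embeds G (Quotient.quot N) -> direct_summand N.

Definition torsion (G : zmodType) : Prop :=
  forall x : G, exists2 n : nat, (0 < n)%N & x *+ n = 0.

Definition in_primary_component (G : zmodType) (p : nat) (x : G) : Prop :=
  exists k : nat, x *+ (p ^ k)%N = 0.

Definition elementary (G : zmodType) : Prop :=
  torsion G /\
  forall (p : nat) (x : G), prime p -> in_primary_component p x -> x *+ p = 0.

Definition BE_group (G : zmodType) : Prop :=
  exists A E : zmodClosed G,
    [/\ direct_sum A E, bassian (subgroup_type A) & elementary (subgroup_type E)].

(* Main.v *)
Require Import Defs.
From HB Require Import structures.
From mathcomp Require Import all_boot all_order all_algebra.
From mathcomp Require Import boolp classical_sets cardinality.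
From mathcomp Require Import ring.

(** Write T_p for the p-primary component of G.  Being generalized Bassian and
    being a B+E-group both amount to one finiteness condition: G has finite
    torsion-free rank, and p T_p is finite for every prime p.

    Necessity rests on divisible sections.  Let C be a subgroup of G with a
    surjection theta and an injection iota from C to the same divisible
    group D, and let N be the kernel of theta.  Both maps extend to G,
    because divisible groups are injective, and moving x by an element of C
    that theta sends to iota(x) - theta(x), for the extended maps, embeds G
    into G/N.  If G is generalized Bassian, then N is a summand, so C = N + M
    with M isomorphic to the divisible group D ([divisible_section]).  A
    direct sum C of infinitely many cyclic groups has no such M, whereas it
    does have such theta and iota if it is free (for D = Q[X]) or if it is a
    p-group with cyclic summands of large enough orders (for D = Q[X] modulo
    the p-integral polynomials).  So the rank is finite and some
    p^n T_p has a finite socle.  Taking theta to be multiplication by p and iota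
    the identity shows that T_p has no nonzero divisible subgroup, so T_p has
    bounded exponent.  If p T_p were still infinite, G would have a pure subgroup
    C that is a direct sum of infinitely many copies of Z/p^(k+1) with k > 0: the
    endomorphism that is a shift on C and the identity on a complement embeds G
    into G/N for a subgroup N of order p inside p^k C, and N is not a summand
    because it lies in pG ([socle_finite_pred]).

    For sufficiency, let N be a subgroup and phi an embedding of G into G/N.
    Counting ranks, N is torsion.  Choose a finitely generated F with G/F
    torsion; some k > 0 has k phi(F) inside the image of F.  For p prime to k,
    the group Y of the elements of T_p in F + pG is finite, and k phi maps Y
    injectively into the image of Y in G/N.  By counting, the projection to G/N
    is injective on Y, so N meets Y trivially.  The same holds for p dividing k
    with F replaced by 0.  Let C be the intersection over all p of these groups
    F + pG (pG when p divides k).  Then N and C meet trivially and every element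
    of G/C has square-free order, which makes N a summand ([local_summand],
    [generalized_bassian_of_finite]).

    The same criterion produces the decomposition: in the subgroup S of the
    elements of square-free order, choose a complement E of the intersection of
    S with all F + pG.  Then E is elementary and is a summand of G, and what is
    left has finite primary components and finite rank, hence is Bassian. *)

Set Implicit Arguments.
Unset Strict Implicit.
Unset Printing Implicit Defensive.

Import Order.TTheory GRing.Theory Num.Theory.
Local Open Scope classical_set_scope.
Local Open Scope quotient_scope.
Local Open Scope ring_scope.

(** * Subgroups, quotients and extension of homomorphisms *)

Section SubgroupOf.
Variables (G : zmodType) (P : G -> Prop).
Hypotheses (P0 : P 0) (PB : forall x y, P x -> P y -> P (x - y)).

Fact subgroup_of_closed : zmod_closed (fun x => `[< P x >] : bool).
Proof.
split=> [|x y /asboolP Px /asboolP Py]; apply/asboolP; first exact: P0.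
exact: PB.
Qed.

Definition subgroup_of : zmodClosed G :=
  HB.pack (fun x => `[< P x >] : bool)
    (GRing.isZmodClosed.Build G _ subgroup_of_closed).

Lemma in_subgroup_of x : x \in subgroup_of <-> P x.
Proof. by split=> /asboolP. Qed.

End SubgroupOf.

Lemma trivial_subgroup_closed (G : zmodType) (x y : G) :
  x = 0 -> y = 0 -> x - y = 0.
Proof. by move=> -> ->; rewrite subrr. Qed.

Definition trivial_subgroup (G : zmodType) : zmodClosed G :=
  subgroup_of (erefl (0 : G)) (@trivial_subgroup_closed G).

Lemma rpredMz (G : zmodType) (N : zmodClosed G) x (z : int) :
  x \in N -> x *~ z \in N.
Proof.
move=> Nx; case: z => n; first by rewrite -pmulrn rpredMn.
by rewrite NegzE -nmulrn rpredN rpredMn.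
Qed.

Definition additive_of (A B : zmodType) (f : A -> B) (fB : zmod_morphism f) :
  {additive A -> B} := HB.pack f (GRing.isZmodMorphism.Build A B f fB).

Section Quotients.
Variables (G : zmodType) (N : zmodClosed G).

Definition quot_proj : {additive G -> Quotient.quot N} := \pi_(Quotient.quot N).

Lemma quot_proj_eq0 x : quot_proj x = 0 <-> x \in N.
Proof.
rewrite -[x in x \in N]subr0 Quotient.idealrBE.
have q0 : quot_proj 0 = 0 := raddf0 _.
split=> [px0|/eqP px0]; last by rewrite -q0; exact: px0.
by apply/eqP; rewrite -[LHS]/(quot_proj x) px0 -q0.
Qed.

Lemma quot_proj_onto y : exists x, quot_proj x = y.
Proof. by exists (repr y); rewrite /quot_proj /= reprK. Qed.

End Quotients.

(** A homomorphism from a subgroup of G to D, encoded by its graph so that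
    maximal extensions can be taken as unions of sets. *)
Record partial_hom (G D : zmodType) (R : G -> D -> Prop) : Prop := PartialHom {
  partial_hom0 : R 0 0;
  partial_homB : forall x y d e, R x d -> R y e -> R (x - y) (d - e);
  partial_hom_fun : forall d, R 0 d -> d = 0
}.

Section PartialHom.
Variables (G D : zmodType) (R : G -> D -> Prop) (hR : partial_hom R).

Lemma partial_homN x d : R x d -> R (- x) (- d).
Proof.
move=> Rxd; rewrite -[- x]sub0r -[- d]sub0r.
by apply: partial_homB => //; case: hR.
Qed.

Lemma partial_homD x y d e : R x d -> R y e -> R (x + y) (d + e).
Proof.
move=> Rxd Rye; rewrite -[y]opprK -[e]opprK.
exact: partial_homB Rxd (partial_homN Rye).
Qed.

Lemma partial_homMz x d z : R x d -> R (x *~ z) (d *~ z).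
Proof.
move=> Rxd; have Rn n : R (x *+ n) (d *+ n).
  by elim: n => [|n IH]; [case: hR | rewrite !mulrS; exact: partial_homD].
case: z => n; first by rewrite -!pmulrn.
by rewrite NegzE -!nmulrn; apply: partial_homN.
Qed.

Lemma partial_hom_eq x d e : R x d -> R x e -> d = e.
Proof.
move=> Rd Re; apply/eqP; rewrite -subr_eq0; apply/eqP.
by apply: (partial_hom_fun hR); rewrite -(subrr x); apply: partial_homB.
Qed.

(** A graph that is defined everywhere is a homomorphism; the homomorphisms
    that need a choice of preimages are obtained in this way. *)
Lemma partial_hom_total :
  (forall x, exists d, R x d) ->
  exists h : {additive G -> D}, forall x d, R x d -> h x = d.
Proof.
move=> /boolp.choice[h Rh].
have hB : zmod_morphism h.
  move=> x y; apply: partial_hom_eq (Rh _) _; exact: partial_homB.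
exists (additive_of hB) => x d Rxd /=.
exact: partial_hom_eq (Rh x) Rxd.
Qed.

End PartialHom.

(** The new value d0 at x0 is compatible with R as soon as it agrees with R on
    the multiples of x0 in the domain of R. *)
Lemma partial_hom_step (G D : zmodType) (R : G -> D -> Prop) (x0 : G) (d0 : D) :
  partial_hom R -> (forall z e, R (x0 *~ z) e -> e = d0 *~ z) ->
  partial_hom (fun x d => exists y e z, [/\ R y e, x = y + x0 *~ z & d = e + d0 *~ z]).
Proof.
move=> hR Rd0; split.
- by exists 0, 0, 0; split; rewrite ?addr0 //; case: hR.
- move=> x x' d d' [y [e [z [Rye -> ->]]]] [y' [e' [z' [Rye' -> ->]]]].
  exists (y - y'), (e - e'), (z - z'); split; first exact: partial_homB.
    by rewrite mulrzBr opprD addrACA.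
  by rewrite mulrzBr opprD addrACA.
- move=> d [y [e [z [Rye y0 ->]]]].
  have yE : y = - (x0 *~ z) by apply/eqP; rewrite -addr_eq0 -y0.
  have := partial_homN hR Rye; rewrite yE opprK => /Rd0 <-.
  by rewrite subrr.
Qed.

(** A maximal extension is total: if x is outside its domain and n is the least
    positive integer with n x inside, then any d' such that n d' is the value at
    n x extends the graph to x.  The divisibility of values is asked only of
    extensions of R0, which covers divisible targets as well as targets and
    sources of bounded exponent. *)
Lemma partial_hom_extend (G D : zmodType) (R0 : G -> D -> Prop) :
  partial_hom R0 ->
  (forall R : G -> D -> Prop, partial_hom R -> (forall x d, R0 x d -> R x d) ->
    forall x n d, (0 < n)%N -> R (x *+ n) d -> exists d', d = d' *+ n) ->
  exists h : {additive G -> D}, forall x d, R0 x d -> h x = d.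
Proof.
move=> hR0 divR.
(* R0 is joined to every set of the chain so that the empty chain is bounded too. *)
pose rel (X : set (G * D)) x d := R0 x d \/ X (x, d).
have [A [hA maxA]] : exists A, partial_hom (rel A) /\
    forall B, A `<` B -> ~ partial_hom (rel B).
  apply: Zorn_bigcup => F FP Ftot; split.
  - by left; case: hR0.
  - have cover x d : rel (\bigcup_(X in F) X) x d -> exists X,
        (F X \/ X = set0) /\ rel X x d.
      case=> [?|[X FX Xxd]]; first by exists set0; split; [right|left].
      by exists X; split; [left|right].
    have back X x d : F X \/ X = set0 -> rel X x d ->
        rel (\bigcup_(X in F) X) x d.
      by case=> [FX|->] [?|//]; [left|right; exists X|left].
    have homX X : F X \/ X = set0 -> partial_hom (rel X).
      case=> [/FP //|->]; case: hR0 => h0 hB h1; split; first by left.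
      - by move=> x y d e [?|//] [?|//]; left; apply: hB.
      - by move=> d [|//]; apply: h1.
    move=> x y d e /cover[X [FX Xxd]] /cover[Y [FY Yye]].
    have [XY|YX] : X `<=` Y \/ Y `<=` X.
      case: FX => [FX|->]; last by left=> ?.
      case: FY => [FY|->]; last by right=> ?.
      exact: Ftot.
    + apply: (back Y) => //; apply: partial_homB => //; first exact: homX.
      by case: Xxd => [?|/XY ?]; [left|right].
    + apply: (back X) => //; apply: partial_homB => //; first exact: homX.
      by case: Yye => [?|/YX ?]; [left|right].
  - move=> d [|[X FX X0]]; first exact: (partial_hom_fun hR0).
    by apply: (partial_hom_fun (FP X FX)); right.
have R0A x d : R0 x d -> rel A x d by left.
have totA : forall x, exists d, rel A x d.
  move=> x; apply: contrapT => xA.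
  have [d0 d0P] : exists d0, forall z e, rel A (x *~ z) e -> e = d0 *~ z.
    have [[n [n0 [d And]]]|nex] :=
      pselect (exists n, (0 < n)%N /\ exists d, rel A (x *+ n) d); last first.
      exists 0 => z e; rewrite mul0rz; case: z => [[|n]|n].
      - by rewrite mulr0z; apply: (partial_hom_fun hA).
      - by move=> Ae; case: nex; exists n.+1; split=> //; exists e.
      - rewrite NegzE mulrNz => /(partial_homN hA); rewrite opprK => Ae.
        by case: nex; exists n.+1; split=> //; exists (- e).
    pose S n := `[< (0 < n)%N /\ exists d, rel A (x *+ n) d >].
    have exS : exists n, S n by exists n; apply/asboolP; split=> //; exists d.
    case: (ex_minnP exS) => m /asboolP[m0 [dm Adm]] minm.
    have [d' d'E] := divR _ hA R0A _ _ _ m0 Adm.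
    exists d' => z e Aze.
    have mz0 : m%:Z != 0 by rewrite eqz_nat -lt0n.
    have qE := divz_eq z m; set q := (z %/ m)%Z in qE; set r := (z %% m)%Z in qE.
    have Aq : rel A (x *~ (q * m)) (d' *~ (q * m)).
      rewrite mulrC !mulrzA -!pmulrn -d'E; exact: partial_homMz.
    have rN : r = `|r|%N by rewrite gez0_abs // modz_ge0.
    have Ar : rel A (x *+ `|r|%N) (e - d' *~ (q * m)).
      have -> : x *+ `|r|%N = x *~ z - x *~ (q * m).
        by rewrite -mulrzBr {1}qE addrC addKr pmulrn -rN.
      exact: partial_homB.
    have r0 : r = 0.
      rewrite rN; case: (posnP `|r|%N) => [->//|rpos].
      have /minm : S `|r|%N by apply/asboolP; split=> //; eexists; exact: Ar.
      by rewrite leqNgt -ltz_nat -rN ltz_pmod.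
    rewrite qE r0 addr0; move: Aze; rewrite {1}qE r0 addr0.
    by move=> /(partial_hom_eq hA); apply.
  have hB := partial_hom_step hA d0P.
  pose B : set (G * D) := fun u => exists y e z,
    [/\ rel A y e, u.1 = y + x *~ z & u.2 = e + d0 *~ z].
  have AB : forall y e, rel A y e -> B (y, e).
    by move=> y e Aye; exists y, e, 0; rewrite !addr0.
  apply: (maxA B).
    split; first by case=> y e Aye; apply: AB; right.
    move=> BA; apply: xA; exists d0; right; apply: BA.
    by exists 0, 0, 1; rewrite !add0r; split=> //; left; case: hR0.
  have -> : rel B = fun y e => B (y, e).
    apply/funext => y; apply/funext => e; apply/propext; split; last by right.
    by case=> [/R0A/AB|].
  exact: hB.
have [h hP] := partial_hom_total hA totA.
by exists h => x d /R0A/hP.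
Qed.

Definition divisible (D : zmodType) : Prop :=
  forall (d : D) n, (0 < n)%N -> exists d', d = d' *+ n.

Lemma image_partial_hom (A G D : zmodType) (f : {additive A -> G})
    (h : {additive A -> D}) :
  (forall a, f a = 0 -> h a = 0) ->
  partial_hom (fun x d => exists a, x = f a /\ d = h a).
Proof.
move=> fh; split.
- by exists 0; rewrite !raddf0.
- by move=> x y d e [a [-> ->]] [b [-> ->]]; exists (a - b); rewrite !raddfB.
- by move=> d [a [/esym /fh ha ->]].
Qed.

Lemma divisible_injective (A G D : zmodType) (f : {additive A -> G})
    (h : {additive A -> D}) :
  divisible D -> (forall a, f a = 0 -> h a = 0) ->
  exists h' : {additive G -> D}, forall a, h' (f a) = h a.
Proof.
move=> divD /image_partial_hom/partial_hom_extend[R _ _ x n d n0 _|h' h'P].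
  exact: divD.
by exists h' => a; apply: h'P; exists a.
Qed.

Lemma bezout_int (m n : nat) : exists u v : int, u * m%:Z + v * n%:Z = (gcdn m n)%:Z.
Proof. by have [u [v uv]] := Bezoutz m n; exists u, v; rewrite uv. Qed.

(** Suppose f(a) = m x and h(a) = 0, and let d be the value at n x of some
    extension.  With g = gcd(n, m) = u n + v m, the value at g x is u d, and it
    is killed by m / g because the value at m x is 0.  The last hypothesis then
    makes u d divisible by g, hence d divisible by n.  It holds for modules that
    are free over Z/m, and for arbitrary D when m is square-free. *)
Lemma torsion_extension (A G D : zmodType) (f : {additive A -> G})
    (h : {additive A -> D}) :
  (forall a, f a = 0 -> h a = 0) ->
  (forall x, exists m a, [/\ (0 < m)%N, f a = x *+ m, h a = 0 &
     forall g k, m = (g * k)%N -> forall d : D, d *+ k = 0 -> exists d', d = d' *+ g]) ->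
  exists h' : {additive G -> D}, forall a, h' (f a) = h a.
Proof.
move=> fh H; have hR0 := image_partial_hom fh.
have [|h' h'P] := partial_hom_extend hR0; last first.
  by exists h' => a; apply: h'P; exists a.
move=> R hR R0R x n d n0 Rnd.
have [m [a [m0 fa ha mP]]] := H x.
have Rm : R (x *+ m) 0 by rewrite -fa -ha; apply: R0R; exists a.
have [u [v uv]] := bezout_int n m; set g := gcdn n m in uv.
have [k mE] : exists k, m = (g * k)%N.
  by have /dvdnP[k ->] := dvdn_gcdr n m; exists k; rewrite mulnC.
have [l nE] : exists l, n = (g * l)%N.
  by have /dvdnP[l ->] := dvdn_gcdl n m; exists l; rewrite mulnC.
have Rg : R (x *+ g) (d *~ u).
  rewrite pmulrn -uv mulrzDr [u * _]mulrC [v * _]mulrC !mulrzA -!pmulrn.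
  rewrite -[d *~ u]addr0 -[0](mul0rz _ v).
  by apply: (partial_homD hR); apply: (partial_homMz hR).
have uk : d *~ u *+ k = 0.
  apply: (partial_hom_eq hR) Rm.
  by rewrite mE mulrnA (pmulrn (x *+ g)) (pmulrn (d *~ u)); exact: partial_homMz.
have [d' d'E] := mP _ _ mE _ uk.
exists d'; apply: (partial_hom_eq hR Rnd).
rewrite nE !mulrnA -d'E (pmulrn (x *+ g)) (pmulrn (d *~ u)).
exact: partial_homMz.
Qed.

Definition subgroup_incl (G : zmodType) (N : zmodClosed G) :
  {additive subgroup_type N -> G} := val.

Lemma subgroup_inclP (G : zmodType) (N : zmodClosed G) (x : G) :
  x \in N -> exists u, subgroup_incl N u = x.
Proof. by move=> Nx; exists (SubgroupElt Nx). Qed.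

(** * Summands and divisible sections *)

Lemma retract_summand (G : zmodType) (N : zmodClosed G)
    (h : {additive G -> subgroup_type N}) :
  (forall u, h (subgroup_incl N u) = u) -> direct_summand N.
Proof.
move=> hN; pose P x := h x = 0.
have PB x y : P x -> P y -> P (x - y) by rewrite /P raddfB => -> ->; rewrite subrr.
exists (subgroup_of (raddf0 h : P 0) PB); split.
  move=> x; exists (subgroup_incl N (h x)), (x - subgroup_incl N (h x)); split.
  - exact: subgroup_valP.
  - by apply/in_subgroup_of; rewrite /P raddfB hN subrr.
  - by rewrite addrC subrK.
move=> x /subgroup_inclP[u <-] /in_subgroup_of; rewrite /P hN => ->.
by rewrite raddf0.
Qed.

Definition square_free m := forall q, prime q -> ~~ (q * q %| m)%N.


Lemma square_free_coprime g k : (0 < g * k)%N -> square_free (g * k) -> coprime g k.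
Proof.
move=> gk0 sf; rewrite /coprime; have d0 : (0 < gcdn g k)%N.
  by rewrite gcdn_gt0; case: g gk0 {sf}.
case: (ltnP 1 (gcdn g k)) => [/pdivP[q q_pr]|]; last by case: (gcdn g k) d0 => [|[|]].
rewrite dvdn_gcd => /andP[qg qk].
by have := sf q q_pr; rewrite dvdn_mul.
Qed.

(** The identity of N extends to N + C by zero on C, and then to G: modulo C all
    orders m are square-free, so that for m = g k the integers g and k are
    coprime, and an element killed by k is divisible by g. *)
Lemma square_free_summand (G : zmodType) (N C : zmodClosed G) :
  (forall x, x \in N -> x \in C -> x = 0) ->
  (forall x, exists m, [/\ (0 < m)%N, square_free m & x *+ m \in C]) ->
  direct_summand N.
Proof.
move=> NC torC.
pose A := (subgroup_type N * subgroup_type C)%type : zmodType.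
pose f0 (a : A) : G := subgroup_incl N a.1 + subgroup_incl C a.2.
have f0B : zmod_morphism f0.
  by move=> a b; rewrite /f0 !raddfB opprD addrACA.
pose f := additive_of f0B.
have [||h hP] := @torsion_extension A G (subgroup_type N) f fst.
- move=> [n c] /eqP; rewrite /= /f0 addr_eq0 => /eqP nc /=.
  apply: val_inj; apply: NC; first exact: subgroup_valP.
  by rewrite -[val n]/(subgroup_incl N n) nc rpredN; apply: subgroup_valP.
- move=> x; have [m [m0 sfm /subgroup_inclP[c cE]]] := torC x.
  exists m, ((0, c) : A); split=> //.
    by rewrite /= /f0 raddf0 add0r.
  move=> g k mE d dk; rewrite mE in m0 sfm.
  have [u [v]] := bezout_int g k.
  rewrite (eqP (square_free_coprime m0 sfm)) => uv.
  exists (d *~ u); rewrite -[LHS]mulr1n [LHS]pmulrn -uv mulrzDr mulrzA [v * _]mulrC mulrzA.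
  by rewrite -!pmulrn dk mul0rz addr0.
- apply: (@retract_summand _ _ h) => u.
  by rewrite -[RHS](hP ((u, 0) : A)) /= /f0 raddf0 addr0.
Qed.

(** The kernel N of theta on f(A) admits an embedding of G into G/N, namely x goes
    to the class of x + f(a), where theta(a) = S(x) - T(x) for extensions S and T
    of iota and theta to G.  A complement of N in G meets f(A) in a group
    isomorphic to D. *)
Lemma divisible_section (A G D : zmodType) (f : {additive A -> G})
    (theta iota : {additive A -> D}) :
  generalized_bassian G -> divisible D -> (forall d, exists a, theta a = d) ->
  (forall a, f a = 0 -> theta a = 0) -> (forall a, f a = 0 <-> iota a = 0) ->
  exists M : zmodClosed G, (forall d, exists a, f a \in M /\ theta a = d) /\
    (forall a, f a \in M -> theta a = 0 -> f a = 0).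
Proof.
move=> gbG divD theta_onto ftheta fiota.
have [T TE] := divisible_injective divD ftheta.
have [S SE] := divisible_injective divD (fun a => (fiota a).1).
pose P x := exists a, x = f a /\ theta a = 0.
have P0 : P 0 by exists 0; rewrite !raddf0.
have PB x y : P x -> P y -> P (x - y).
  move=> [a [-> ta]] [b [-> tb]]; exists (a - b).
  by rewrite !raddfB ta tb subrr.
pose N := subgroup_of P0 PB.
pose R x (y : Quotient.quot N) := exists a, y = quot_proj N (x + f a) /\ theta a = S x - T x.
have hR : partial_hom R.
  split.
  - by exists 0; rewrite !(raddf0, addr0, subr0).
  - move=> x y d e [a [-> ta]] [b [-> tb]]; exists (a - b).
    split; last by rewrite !raddfB ta tb !opprD addrACA.
    by rewrite -raddfB (raddfB f) opprD addrACA.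
  - move=> d [a [-> ta]]; apply/quot_proj_eq0/in_subgroup_of.
    by exists a; rewrite add0r ta !(raddf0, addr0).
have [x|h hP] := partial_hom_total hR.
  by have [a ta] := theta_onto (S x - T x); exists (quot_proj N (x + f a)), a.
have [|M [NM1 NM2]] := gbG N.
  exists h; apply: raddf_inj => x.
  have [a ta] := theta_onto (S x - T x).
  rewrite (hP x (quot_proj N (x + f a))); last by exists a.
  move=> /quot_proj_eq0/in_subgroup_of[b [xE tb]].
  have {}xE : x = f (b - a) by rewrite raddfB -xE addrK.
  have : S x = 0.
    by rewrite -[S x](subrK (T x)) -ta xE TE raddfB tb sub0r subrr.
  by rewrite xE SE => /fiota.
exists M; split.
  move=> d; have [a ta] := theta_onto d.
  have [n [m [/in_subgroup_of[b [-> tb]] Mm faE]]] := NM1 (f a).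
  by exists (a - b); rewrite !raddfB faE addrC addKr ta tb subr0.
by move=> a Ma ta; apply: NM2 => //; apply/in_subgroup_of; exists a.
Qed.

(** * Linear combinations and torsion-free rank *)

Definition lincomb (G : zmodType) (c : nat -> G) n (z : nat -> int) : G :=
  \sum_(j < n) c j *~ z j.

Section Lincomb.
Variables (G : zmodType) (c : nat -> G).

Lemma eq_lincomb c' n z z' :
  (forall j, (j < n)%N -> c j *~ z j = c' j *~ z' j) ->
  lincomb c n z = lincomb c' n z'.
Proof. by move=> E; apply: eq_bigr => j _; apply: E. Qed.

Lemma lincombB n z z' :
  lincomb c n z - lincomb c n z' = lincomb c n (fun j => z j - z' j).
Proof. by rewrite -sumrB; apply: eq_bigr => j _; rewrite mulrzBr. Qed.

Lemma lincombMz n z (a : int) :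
  lincomb c n z *~ a = lincomb c n (fun j => z j * a).
Proof. by rewrite mulrz_suml; apply: eq_bigr => j _; rewrite mulrzA. Qed.

Lemma lincombMn n z (a : nat) :
  lincomb c n z *+ a = lincomb c n (fun j => z j * a%:Z).
Proof. by rewrite pmulrn lincombMz. Qed.

Lemma lincombS n z : lincomb c n.+1 z = lincomb c n z + c n *~ z n.
Proof. by rewrite /lincomb big_ord_recr. Qed.

Lemma lincomb0 n : lincomb c n (fun=> 0) = 0.
Proof. by rewrite /lincomb big1. Qed.

End Lincomb.

Lemma raddf_lincomb (G H : zmodType) (f : {additive G -> H}) c n z :
  f (lincomb c n z) = lincomb (f \o c) n z.
Proof. by rewrite raddf_sum; apply: eq_bigr => j _; rewrite raddfMz. Qed.

(** The kernel of the rational matrix is nonzero; clear denominators. *)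
Lemma int_left_kernel m n (M : 'M[int]_(m, n)) :
  (n < m)%N -> exists2 w : 'rV[int]_m, w != 0 & w *m M = 0.
Proof.
move=> ltnm; pose M' := map_mx intr M : 'M[rat]_(m, n).
have : kermx M' != 0.
  rewrite -mxrank_eq0 mxrank_ker subn_eq0 -ltnNge.
  exact: leq_ltn_trans (rank_leq_col _) ltnm.
case/rowV0Pn => v /sub_kermxP vM vn0.
pose D := \prod_i denq (v 0 i).
pose w := \row_i (numq (v 0 i) * \prod_(j | j != i) denq (v 0 j)).
have D0 : D%:~R != 0 :> rat.
  by rewrite intr_eq0; apply/prodf_neq0 => i _; apply: denq_neq0.
have wE : map_mx intr w = D%:~R *: v :> 'rV[rat]_m.
  apply/rowP => i; rewrite !mxE /D [X in _ = X%:~R * _](bigD1 i) //=.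
  by rewrite !intrM numqE; ring.
exists w.
  apply: contraNneq vn0 => w0; move: wE; rewrite w0 map_mx0 => /esym/eqP.
  by rewrite scaler_eq0 (negPf D0).
have wM0 : map_mx intr (w *m M) = 0 :> 'rV[rat]_n.
  by rewrite map_mxM wE -scalemxAl vM scaler0.
apply/rowP => j; have /rowP/(_ j) := wM0; rewrite !mxE => /eqP.
by rewrite intr_eq0 => /eqP.
Qed.

Definition independent (G : zmodType) n (c : nat -> G) : Prop :=
  forall z, lincomb c n z = 0 -> forall j, (j < n)%N -> z j = 0.

Definition spans_up_to_torsion (G : zmodType) n (c : nat -> G) : Prop :=
  forall x, exists m z, (0 < m)%N /\ x *+ m = lincomb c n z.

Definition rank_le (G : zmodType) n : Prop :=
  forall m (c : nat -> G), independent m c -> (m <= n)%N.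

Definition finite_rank (G : zmodType) : Prop := exists n, rank_le G n.

(** More than n elements have multiples that are combinations of n elements, hence
    satisfy a relation given by the left kernel of the coefficient matrix. *)
Lemma rank_le_span (G : zmodType) n (c : nat -> G) :
  spans_up_to_torsion n c -> rank_le G n.
Proof.
move=> span_c m d ind_d; rewrite leqNgt; apply/negP => ltnm.
have /boolp.choice[k kP] : forall i, exists k : nat, exists z,
  (0 < k)%N /\ d i *+ k = lincomb c n z by move=> i; exact: span_c.
have /boolp.choice[z zP] := kP.
pose M := \matrix_(i < m, j < n) z i j.
have [w w0 wM] := int_left_kernel M ltnm.
have [i wi] : exists i, w 0 i != 0.
  apply: contrapT => nw; case/eqP: w0; apply/rowP => i; rewrite mxE.
  by apply: contrapT => wi; apply: nw; exists i; apply/eqP.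
pose w' j := if insub j is Some i' then w 0 i' * (k j)%:Z else 0.
have w'E (j : 'I_m) : w' j = w 0 j * (k j)%:Z by rewrite /w' valK.
have /(ind_d w')/(_ i (ltn_ord i))/eqP : lincomb d m w' = 0.
  transitivity (\sum_(j < m) lincomb c n (fun l => z j l * w 0 j)).
    apply: eq_bigr => j _; rewrite w'E mulrC mulrzA -pmulrn.
    by rewrite (zP j).2 lincombMz.
  rewrite /lincomb exchange_big big1 //= => l _.
  rewrite -mulrz_sumr; have /matrixP/(_ 0 l) := wM; rewrite !mxE => E.
  rewrite [X in _ *~ X](_ : _ = 0) ?mulr0z // -[RHS]E.
  by apply: eq_bigr => j _; rewrite mxE mulrC.
rewrite w'E mulf_eq0 (negPf wi) /= eqz_nat.
by have := (zP i).1; case: (k i).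
Qed.

(** An independent family of maximal size spans up to torsion. *)
Lemma finite_rank_span (G : zmodType) : finite_rank G ->
  exists n c, independent n c /\ @spans_up_to_torsion G n c.
Proof.
move=> [n rkG]; pose S m := `[< exists c : nat -> G, independent m c >].
have exS : exists m, S m by exists 0%N; apply/asboolP; exists (fun=> 0).
have Sle m : S m -> (m <= n)%N by move=> /asboolP[c]; apply: rkG.
case: (ex_maxnP exS Sle) => r /asboolP[c ind_c] maxr.
exists r, c; split=> // x.
pose d j := if (j < r)%N then c j else x.
have : ~ independent r.+1 d.
  by move=> ind_d; have := maxr r.+1 (asboolT (ex_intro _ d ind_d)); rewrite ltnn.
move=> nind; apply: contrapT => nspan; apply: nind => z.
have dE : lincomb d r z = lincomb c r z.
  by apply: eq_lincomb => j jr; rewrite /d jr.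
rewrite lincombS dE {1}/d ltnn => zd0.
have zr0 : z r = 0.
  apply/eqP/negPn/negP => zr; apply: nspan.
  exists `|z r|%N, (fun j => z j * - sgz (z r)); split; first by rewrite absz_gt0.
  rewrite -lincombMz.
  have -> : lincomb c r z = - (x *~ z r) by apply/eqP; rewrite -addr_eq0 zd0.
  by rewrite mulrNz mulNrz opprK -mulrzA mulrC -abszEsg pmulrn.
rewrite zr0 mulr0z addr0 in zd0.
move=> j; rewrite ltnS leq_eqVlt => /orP[/eqP->//|]; exact: ind_c.
Qed.

Lemma rank_le_torsion_kernel (G H : zmodType) (f : {additive G -> H}) n :
  (forall x, f x = 0 -> exists2 m, (0 < m)%N & x *+ m = 0) ->
  rank_le H n -> rank_le G n.
Proof.
move=> kerf rkH m c ind_c; apply: (rkH m (f \o c)) => z.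
rewrite -raddf_lincomb => /kerf[k k0]; rewrite lincombMn => /ind_c z0 j /z0/eqP.
by rewrite mulf_eq0 eqz_nat eqn0Ngt k0 orbF => /eqP.
Qed.

(** * Independent sequences of torsion elements *)

(** Dependent choice where the condition on the n-th term refers to the earlier
    terms; the first hypothesis says that P looks only at these. *)
Lemma prefix_choice (T : Type) (t0 : T) (P : (nat -> T) -> nat -> T -> Prop) :
  (forall c c' n x, (forall j, (j < n)%N -> c j = c' j) -> P c n x -> P c' n x) ->
  (forall c n, exists x, P c n x) ->
  exists c, forall n, P c n (c n).
Proof.
move=> extP exP.
have /boolp.choice[pick pickP] : forall u : (nat -> T) * nat, exists x, P u.1 u.2 x.
  by move=> [c n]; exact: exP.
pose fix pre n : nat -> T := if n is m.+1 then
  (fun j => if j == m then pick (pre m, m) else pre m j) else fun=> t0.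
have preS n j : (j < n)%N -> pre n j = pre j.+1 j.
  elim: n => // n IH; rewrite ltnS leq_eqVlt => /orP[/eqP->//|jn].
  by rewrite -IH //= ltn_eqF.
exists (fun n => pre n.+1 n) => n; apply: (extP (pre n)) => [j /preS//|].
by rewrite /= eqxx; exact: (pickP (_, _)).
Qed.

Lemma finite_lincomb (G : zmodType) (x : nat -> G) p n :
  (0 < p)%N -> (forall j, (j < n)%N -> x j *+ p = 0) ->
  finite_set [set y | exists z, y = lincomb x n z].
Proof.
move=> p0; elim: n => [|n IH] xp.
  by apply: (@sub_finite_set _ _ [set 0]) => // y [z ->]; rewrite /lincomb big_ord0.
have fin1 : finite_set ((fun a : nat => x n *+ a) @` `I_p) by apply: finite_image.
have fin2 := IH (fun j jn => xp j (ltnW jn)).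
apply: sub_finite_set (finite_image2 (fun a b => a + b) fin2 fin1) => y [z ->].
have p0' : p%:Z != 0 by rewrite eqz_nat -lt0n.
exists (lincomb x n z); first by exists z.
have rN : (z n %% p)%Z = `|(z n %% p)%Z|%N by rewrite gez0_abs // modz_ge0.
exists (x n *+ `|(z n %% p)%Z|%N).
  by exists `|(z n %% p)%Z|%N => //=; rewrite -ltz_nat -rN ltz_pmod.
rewrite lincombS {2}(divz_eq (z n) p) mulrzDr [_ * p%:Z]mulrC mulrzA.
by rewrite -(pmulrn (x n) p) xp // mul0rz add0r pmulrn -rN.
Qed.

Lemma order_dvd (G : zmodType) (c : G) p k (a : int) : prime p ->
  c *+ p ^ k <> 0 -> c *+ p ^ k.+1 = 0 -> c *~ a = 0 -> (p ^ k.+1 %| `|a|)%N.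
Proof.
move=> p_pr ck ck1 ca.
have [u [v uv]] : exists u v, u * a + v * (p ^ k.+1)%:Z = gcdn `|a| (p ^ k.+1).
  by have [u [v uv]] := Bezoutz a (p ^ k.+1)%:Z; exists u, v; rewrite uv.
have : (gcdn `|a| (p ^ k.+1) %| p ^ k.+1)%N by apply: dvdn_gcdr.
case/(dvdn_pfactor _ _ p_pr) => e; rewrite leq_eqVlt => /orP[/eqP-> <-|].
  exact: dvdn_gcdl.
rewrite ltnS => ek gE; case: ck; rewrite -(subnKC ek) expnD mulrnA.
rewrite [c *+ _](_ : _ = 0) ?mul0rn // pmulrn -gE -uv mulrzDr.
by rewrite [u * _]mulrC [v * _]mulrC !mulrzA -pmulrn ca ck1 !mul0rz addr0.
Qed.

Section Socle.
Variables (G : zmodType) (p : nat).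
Hypothesis p_pr : prime p.

(** The socle of p^n T_p: the witness g is automatically in T_p. *)
Definition socle_of_multiples n : set G :=
  [set x | (exists g, x = g *+ p ^ n) /\ x *+ p = 0].

(** The elements x_i = p^(k i) c_i are chosen in the socles one after another, each
    outside the sum of U and the span of the previous ones; this avoids only
    finitely many elements of the socle, so infinite socles leave room.  The x_i are
    then independent modulo U, and so are the cyclic groups generated by the c_i,
    since x_i generates the socle of the i-th one. *)
Lemma socle_sequence (U : zmodClosed G) (k : nat -> nat) :
  finite_set [set u | u \in U /\ u *+ p = 0] ->
  (forall i, ~ finite_set (socle_of_multiples (k i))) ->
  exists c : nat -> G,
    [/\ forall i, c i *+ p ^ (k i) <> 0, forall i, c i *+ p ^ (k i).+1 = 0 &
        forall n z, lincomb c n z \in U -> forall j, (j < n)%N -> c j *~ z j = 0].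
Proof.
move=> finU infV.
pose P (x : nat -> G) n y := (forall j, (j < n)%N -> x j *+ p = 0) ->
  socle_of_multiples (k n) y /\ forall z, y - lincomb x n z \notin U.
have [| |x xP] := @prefix_choice G 0 P.
- move=> x x' n y xx' Py x'p; have [|Vy yU] := Py.
    by move=> j jn; rewrite xx' // x'p.
  split=> // z; rewrite (_ : lincomb x' n z = lincomb x n z) //.
  by apply: eq_lincomb => j jn; rewrite xx'.
- move=> x n; have [xp|nxp] := pselect (forall j, (j < n)%N -> x j *+ p = 0); last first.
    by exists 0 => /nxp.
  have finL := finite_lincomb (prime_gt0 p_pr) xp.
  have fin := finite_image2 (fun a b => a + b) finU finL.
  apply: contrapT => nex; apply: (infV n); apply: sub_finite_set fin => y Vy.
  apply: contrapT => ny; apply: nex; exists y => _; split=> // z.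
  apply/negP => yU; apply: ny; exists (y - lincomb x n z).
    split=> //; rewrite mulrnBl Vy.2 sub0r lincombMn /lincomb big1 ?oppr0 // => j _.
    by rewrite mulrC mulrzA -pmulrn xp // mul0rz.
  by exists (lincomb x n z); [exists z | rewrite subrK].
have xpV : forall n, (forall j, (j < n)%N -> x j *+ p = 0).
  elim=> // n IH j; rewrite ltnS leq_eqVlt => /orP[/eqP->|]; last exact: IH.
  by have [[_ ->]] := xP n IH.
have xp n : x n *+ p = 0 by apply: (xpV n.+1).
have xV n : socle_of_multiples (k n) (x n) by have [] := xP n (xpV n).
have xU n z : x n - lincomb x n z \notin U by have [] := xP n (xpV n).
have /boolp.choice[c cE] : forall i, exists g, x i = g *+ p ^ k i.
  by move=> i; have [[g ->] _] := xV i; exists g.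
have cn0 i : c i *+ p ^ k i <> 0.
  move=> ci; have := xU i (fun=> 0); rewrite lincomb0 subr0 cE ci.
  by rewrite rpred0.
have cn1 i : c i *+ p ^ (k i).+1 = 0 by rewrite expnSr mulrnA -cE.
have xpz n (w : int) : x n *~ (w * p%:Z) = 0.
  by rewrite mulrC mulrzA -pmulrn xp mul0rz.
have indx n w : lincomb x n w \in U -> forall j, (j < n)%N -> x j *~ w j = 0.
  elim: n => // n IH; rewrite lincombS => xwU.
  have xn0 : x n *~ w n = 0.
    have [/dvdnP[q qE]|ndvd] := boolP (p %| `|w n|)%N.
      by rewrite [w n]intEsg qE PoszM mulrA xpz.
    have cop : coprime `|w n| p by rewrite coprime_sym prime_coprime.
    have [u [v uv]] : exists u v : int, u * w n + v * p%:Z = 1.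
      by have [u [v uv]] := Bezoutz (w n) p; exists u, v; rewrite uv /gcdz (eqP cop).
    have := xU n (fun j => - (w j * u)).
    suff -> : x n - lincomb x n (fun j => - (w j * u)) =
              (lincomb x n w + x n *~ w n) *~ u by rewrite rpredMz.
    rewrite mulrzDl lincombMz -{1}[x n]mulr1z -uv mulrzDr xpz addr0 addrC.
    rewrite -mulrzA [w n * u]mulrC; congr (_ + _).
    rewrite -sumrN; apply: eq_bigr => j _; by rewrite mulrNz opprK.
  rewrite xn0 addr0 in xwU.
  move=> j; rewrite ltnS leq_eqVlt => /orP[/eqP->//|]; exact: IH.
exists c; split=> // n z cU.
have main e : (forall j, (j < n)%N -> c j *~ z j *+ p ^ e = 0) ->
    forall j, (j < n)%N -> c j *~ z j = 0.
  elim: e => [//|e IH] ce; apply: IH.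
  have /boolp.choice[w wE] : forall j, exists w : int, (j < n)%N ->
      c j *~ z j *+ p ^ e = x j *~ w.
    move=> j; have [jn|] := boolP (j < n)%N; last by exists 0.
    have /(order_dvd p_pr (cn0 j) (cn1 j)) : c j *~ (z j * (p ^ e.+1)%:Z) = 0.
      by rewrite mulrzA -pmulrn ce.
    rewrite expnSr [in X in (_ %| X)%N]expnSr PoszM mulrA abszM.
    rewrite [absz p]absz_nat dvdn_pmul2r ?prime_gt0 // => pkz.
    have /dvdzP[s sE] : ((p ^ k j)%:Z %| z j * (p ^ e)%:Z)%Z by rewrite dvdzE.
    exists s => _; rewrite pmulrn -mulrzA sE mulrC mulrzA -pmulrn.
    by rewrite -cE.
  have xwU : lincomb x n w \in U.
    rewrite (_ : lincomb x n w = lincomb c n z *+ p ^ e) ?rpredMn //.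
    rewrite lincombMn; apply: eq_bigr => j _; rewrite -wE //.
    by rewrite mulrzA pmulrn.
  by move=> j jn; rewrite wE // (indx _ _ xwU).
apply: (main (\sum_(j < n) (k j).+1)%N) => j jn.
rewrite (bigD1 (Ordinal jn)) //= expnD mulrnA.
have -> : c j *~ z j *+ p ^ (k j).+1 = 0; last by rewrite mul0rn.
by rewrite pmulrn -mulrzA mulrC mulrzA -pmulrn cn1 mul0rz.
Qed.

End Socle.

(** * Finite torsion-free rank *)

Section PolyComb.
Variables (G : zmodType) (c : nat -> G).

(** The combinations of all terms of c, parametrized by {poly int}, which
    stands for the free abelian group on countably many generators. *)
Definition poly_comb (q : {poly int}) : G := lincomb c (size q) (nth 0 q).

Lemma poly_comb_widen (q : {poly int}) n :
  (size q <= n)%N -> poly_comb q = lincomb c n (nth 0 q).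
Proof.
move=> qn; rewrite /poly_comb -(subnKC qn).
elim: (n - size q)%N => [|k IH]; first by rewrite addn0.
by rewrite addnS lincombS -IH nth_default ?leq_addr // mulr0z addr0.
Qed.

Lemma poly_comb_zmod_morphism : zmod_morphism poly_comb.
Proof.
move=> q r; pose n := (maxn (size q) (size r)).
have qn : (size q <= n)%N by rewrite leq_maxl.
have rn : (size r <= n)%N by rewrite leq_maxr.
rewrite (poly_comb_widen qn) (poly_comb_widen rn) (@poly_comb_widen _ n).
  by rewrite lincombB; apply: eq_bigr => j _; rewrite coefB.
by rewrite (leq_trans (size_polyD _ _)) // size_polyN.
Qed.

HB.instance Definition _ :=
  GRing.isZmodMorphism.Build {poly int} G poly_comb poly_comb_zmod_morphism.

Lemma poly_comb_eq0 (q : {poly int}) : (forall i, c i *~ q`_i = 0) -> poly_comb q = 0.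
Proof. by move=> cq; apply: big1 => i _; apply: cq. Qed.

Lemma poly_combXn i : poly_comb 'X^i = c i.
Proof.
rewrite /poly_comb size_polyXn lincombS coefXn eqxx mulr1z -[RHS]add0r.
by congr (_ + _); apply: big1 => j _; rewrite coefXn ltn_eqF.
Qed.

Lemma poly_combC (a : int) : poly_comb a%:P = c 0%N *~ a.
Proof.
by rewrite -(poly_combXn 0) -raddfMz expr0 -[a in LHS]intz rmorph_int.
Qed.

End PolyComb.

Lemma raddf_poly_comb (G H : zmodType) (f : {additive G -> H}) c q :
  f (poly_comb c q) = poly_comb (f \o c) q.
Proof. exact: raddf_lincomb. Qed.

Lemma coef_poly_comb_Xn (w : nat -> rat) (q : {poly int}) j :
  (poly_comb (fun i => w i *: 'X^i) q)`_j = w j *~ q`_j.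
Proof.
rewrite -[LHS]/(coefp j _) raddf_poly_comb.
have jn : (j < maxn (size q) j.+1)%N by rewrite leq_maxr.
rewrite (poly_comb_widen _ (leq_maxl (size q) j.+1)) /lincomb.
rewrite (bigD1 (Ordinal jn)) //= big1 ?addr0 => [|i].
  by rewrite coefZ coefXn eqxx mulr1.
rewrite -val_eqE /= => ij; rewrite coefZ coefXn eq_sym (negPf ij) mulr0.
by rewrite mul0rz.
Qed.

(** Divisibility is tested at the order of c if it is finite, and otherwise at an
    integer larger than the absolute value of z. *)
Lemma cyclic_reduced (G : zmodType) (c : G) (z : int) :
  (forall n, (0 < n)%N -> exists z', c *~ z = c *~ (z' * n%:Z)) -> c *~ z = 0.
Proof.
move=> H; have [[m [m0 cm]]|tf] := pselect (exists m, (0 < m)%N /\ c *+ m = 0).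
  by have [z' ->] := H m m0; rewrite mulrC mulrzA -pmulrn cm mul0rz.
have tfz y : c *~ y = 0 -> y = 0.
  move=> cy; apply/eqP/negPn/negP => y0; apply: tf; exists `|y|%N.
  by rewrite absz_gt0 y0 pmulrn abszEsg mulrC mulrzA cy mul0rz.
have [z' /eqP] := H `|z|.+1 isT; rewrite -subr_eq0 -mulrzBr => /eqP/tfz/eqP.
rewrite subr_eq0 => /eqP zE.
case: (eqVneq z' 0) => [z'0|z'0]; first by rewrite zE z'0 mul0r.
have := congr1 absz zE; rewrite abszM absz_nat => zE'.
have : (`|z| < `|z|)%N by rewrite {2}zE' leq_pmull ?absz_gt0.
by rewrite ltnn.
Qed.

Lemma rat_poly_image_divisible (D : zmodType) (f : {additive {poly rat} -> D}) :
  (forall d, exists q, f q = d) -> divisible D.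
Proof.
move=> f_onto d n n0; have [q <-] := f_onto d.
exists (f (n%:R^-1 *: q)); rewrite -raddfMn -scaler_nat scalerA divff ?scale1r //.
by rewrite pnatr_eq0 -lt0n.
Qed.

Definition enum_rat_poly i : {poly rat} := odflt 0 (unpickle i).

Lemma enum_rat_poly_onto q : exists i, enum_rat_poly i = q.
Proof. by exists (pickle q); rewrite /enum_rat_poly pickleK. Qed.

(** For D = Q[X]/J[X], the first condition relating c and J says that sending c_i to
    w_i X^i embeds the sum of the cyclic groups of the c_i into D, and the second
    one that sending c_i to the i-th element of an enumeration of Q[X] defines a
    surjection of this sum onto D.  By
    [divisible_section] a subgroup of this sum maps isomorphically onto D; its
    elements are divisible in a direct sum of cyclic groups, hence zero, and so
    D = 0. *)
Lemma divisible_image_trivial (G : zmodType) (c : nat -> G) (w : nat -> rat)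
    (J : zmodClosed rat) :
  generalized_bassian G ->
  (forall q : {poly int}, poly_comb c q = 0 -> forall i, c i *~ q`_i = 0) ->
  (forall i z, c i *~ z = 0 <-> w i *~ z \in J) ->
  (forall i z, c i *~ z = 0 -> forall j, (enum_rat_poly i)`_j *~ z \in J) ->
  forall x : rat, x \in J.
Proof.
move=> gbG ind_c cJ enumJ x.
pose K0 (q : {poly rat}) := forall j, q`_j \in J.
have K00 : K0 0 by move=> j; rewrite coef0 rpred0.
have K0B q r : K0 q -> K0 r -> K0 (q - r) by move=> Kq Kr j; rewrite coefB rpredB.
pose K := subgroup_of K00 K0B.
pose theta : {additive {poly int} -> Quotient.quot K} :=
  poly_comb (quot_proj K \o enum_rat_poly).
pose iota : {additive {poly int} -> Quotient.quot K} :=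
  poly_comb (quot_proj K \o (fun i => w i *: 'X^i)).
have divD : divisible (Quotient.quot K) := rat_poly_image_divisible (@quot_proj_onto _ K).
have theta_onto d : exists a, theta a = d.
  have [q <-] := quot_proj_onto d; have [i <-] := enum_rat_poly_onto q.
  by exists 'X^i; rewrite /= poly_combXn.
have ftheta q : poly_comb c q = 0 -> theta q = 0.
  move=> /ind_c cq; apply: poly_comb_eq0 => i /=.
  rewrite -raddfMz; apply/quot_proj_eq0/in_subgroup_of => j.
  by rewrite -[_`_j]/(coefp j _) raddfMz; apply: enumJ.
have fiota q : poly_comb c q = 0 <-> iota q = 0.
  rewrite /= -raddf_poly_comb; split=> [/ind_c cq|].
    apply/quot_proj_eq0/in_subgroup_of => j.
    by rewrite coef_poly_comb_Xn; apply/cJ.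
  move=> /quot_proj_eq0/in_subgroup_of Kq; apply: poly_comb_eq0 => i.
  by apply/cJ; rewrite -coef_poly_comb_Xn.
have [M [M_onto M_inj]] := divisible_section gbG divD theta_onto ftheta fiota.
apply: contrapT => xJ; apply: xJ.
have [a [Ma ta]] := M_onto (quot_proj K x%:P).
suff fa : poly_comb c a = 0.
  have /quot_proj_eq0/in_subgroup_of/(_ 0%N) : quot_proj K x%:P = 0.
    by rewrite -ta ftheta.
  by rewrite coefC eqxx.
apply: poly_comb_eq0 => i; apply: cyclic_reduced => n n0.
have [d dE] := divD (theta a) n n0.
have [b [Mb tb]] := M_onto d.
have : poly_comb c (a - b *+ n) = 0.
  apply: M_inj; first by rewrite raddfB raddfMn rpredB // rpredMn.
  by rewrite raddfB raddfMn /= -[poly_comb _ b]/(theta b) tb -dE subrr.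
move=> /ind_c/(_ i); rewrite coefB coefMn mulrzBr pmulrn mulrzz => /eqP.
by rewrite subr_eq0 => /eqP ->; exists b`_i.
Qed.

(** Otherwise there is a free subgroup of infinite rank, to which
    [divisible_image_trivial] applies with J = 0. *)
Lemma generalized_bassian_finite_rank (G : zmodType) :
  generalized_bassian G -> finite_rank G.
Proof.
move=> gbG; have [[n [c spc]]|nspan] :=
    pselect (exists n c, @spans_up_to_torsion G n c).
  by exists n; exact: rank_le_span spc.
pose P (c : nat -> G) n x := forall m z, (0 < m)%N -> x *+ m <> lincomb c n z.
have [||c cP] := @prefix_choice G 0 P.
- move=> c c' n x cc' Px m z m0; rewrite (_ : lincomb c' n z = lincomb c n z).
    exact: Px.
  by apply: eq_lincomb => j jn; rewrite cc'.
- move=> c n; apply: contrapT => nx; apply: nspan; exists n, c => x.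
  apply: contrapT => nx'; apply: nx; exists x => m z m0 xm; apply: nx'.
  by exists m, z.
have cP' n z (a : int) : c n *~ a = lincomb c n z -> a = 0.
  move=> ca; apply/eqP/negPn/negP => a0.
  apply: (cP n `|a|%N (fun j => z j * sgz a)); first by rewrite absz_gt0.
  by rewrite pmulrn abszEsg mulrC mulrzA ca lincombMz.
have ind_c q : poly_comb c q = 0 -> q = 0.
  move=> cq; apply/eqP/negPn/negP => q0.
  have sq : size q = (size q).-1.+1 by rewrite prednK // lt0n size_poly_eq0.
  move: cq; rewrite /poly_comb sq lincombS addrC => /eqP.
  rewrite addr_eq0 => /eqP cq; move/eqP: q0; apply.
  apply/eqP; rewrite -lead_coef_eq0; apply/eqP.
  apply: (cP' (size q).-1 (fun j => q`_j * -1)).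
  by rewrite cq -lincombMz mulrNz mulr1z.
have cz0 i z : c i *~ z = 0 -> z = 0.
  by move=> ciz; apply: (cP' i (fun=> 0)); rewrite lincomb0.
have /(_ 1) : forall x, x \in trivial_subgroup rat.
  apply: (@divisible_image_trivial G c (fun=> 1)) => //.
  - by move=> q /ind_c -> i; rewrite coef0.
  - move=> i z; split=> [/cz0->|]; first by rewrite mulr0z rpred0.
    move=> /in_subgroup_of/eqP; rewrite mulrz_eq0 oner_eq0 orbF => /eqP->.
    by rewrite mulr0z.
  - by move=> i z /cz0-> j; rewrite mulr0z rpred0.
by move=> /in_subgroup_of/eqP; rewrite oner_eq0.
Qed.

(** * The socles of the multiples of a primary component *)

Section PLocal.
Variable p : nat.
Hypothesis p_pr : prime p.

Let p_integral (x : rat) := exists n, coprime p n /\ x *+ n \in Num.int.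

Let p_integral0 : p_integral 0.
Proof. by exists 1%N; rewrite coprimen1 rpred0. Qed.

Let p_integralB x y : p_integral x -> p_integral y -> p_integral (x - y).
Proof.
move=> [n [pn xn]] [m [pm ym]]; exists (n * m)%N; split; first by rewrite coprimeMr pn.
by rewrite mulrnBl {2}mulnC !mulrnA rpredB // rpredMn.
Qed.

Definition p_integral_rat : zmodClosed rat := subgroup_of p_integral0 p_integralB.

Lemma p_integral_int (z : int) k :
  (p ^ k)%:R^-1 *~ z \in p_integral_rat <-> (p ^ k %| `|z|)%N.
Proof.
have pk0 : (p ^ k)%:R != 0 :> rat by rewrite pnatr_eq0 expn_eq0 negb_and -lt0n prime_gt0.
split=> [/in_subgroup_of[n [pn /intrP[a aE]]]|/dvdnP[q qE]].
  have : (p ^ k %| absz (z * n%:Z)%R)%N.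
    have zE : z * n%:Z = a * (p ^ k)%:Z.
      apply: (@intr_inj rat); rewrite !intrM -aE -!pmulrn -mulrzl -mulr_natr.
      by field.
    by rewrite zE abszM absz_nat dvdn_mull.
  rewrite abszM absz_nat Gauss_dvdl //; exact: coprimeXl.
apply/in_subgroup_of; exists 1%N; split; first exact: coprimen1.
apply/intrP; exists (sgz z * q%:Z).
rewrite mulr1n {1}[z]intEsg qE PoszM mulrA -mulrzl intrM -pmulrn.
by rewrite mulfK.
Qed.

(** The p-part of a common denominator of the coefficients. *)
Lemma p_integral_denominator (q : {poly rat}) :
  exists k, forall j, q`_j *+ p ^ k \in p_integral_rat.
Proof.
have [r [a a0 ->]] := rat_poly_scale q.
have a0' : (0 < `|a|)%N by rewrite absz_gt0.
have [m pm aE] := pfactor_coprime p_pr a0'.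
exists (logn p `|a|) => j; apply/in_subgroup_of; exists m; split=> //.
apply/intrP; exists (r`_j * sgz a).
rewrite coefZ coef_map /= -mulrnA mulnC -aE -mulr_natl.
rewrite intrM -[`|a|%:R]/((`|a|%N%:Z)%:~R) abszEsg intrM.
by field; rewrite intr_eq0.
Qed.

End PLocal.

Lemma finite_image_kernel (G H : zmodType) (f : {additive G -> H}) (X : set G) :
  (forall x y, X x -> X y -> X (x - y)) ->
  finite_set (f @` X) -> finite_set [set x | X x /\ f x = 0] -> finite_set X.
Proof.
move=> XB finI finK.
have /boolp.choice[s sP] : forall y, exists x, (f @` X) y -> X x /\ f x = y.
  by move=> y; have [[x Xx <-]|] := pselect ((f @` X) y); [exists x|exists 0].
apply: sub_finite_set (finite_image2 (fun x y => s x + y) finI finK) => x Xx.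
have fXx : (f @` X) (f x) by exists x.
have [Xs fs] := sP _ fXx.
exists (f x) => //; exists (x - s (f x)); last by rewrite addrC subrK.
by split; [apply: XB | rewrite raddfB fs subrr].
Qed.

Definition mulrn_hom (G : zmodType) n : {additive G -> G} :=
  additive_of (@mulrnBl G n).

Lemma order_eq0 (G : zmodType) (c : G) p k (a : int) : prime p ->
  c *+ p ^ k <> 0 -> c *+ p ^ k.+1 = 0 ->
  c *~ a = 0 <-> (p ^ k.+1 %| `|a|)%N.
Proof.
move=> p_pr ck ck1; split=> [|/dvdnP[q qE]]; first exact: order_dvd.
by rewrite [a]intEsg qE PoszM mulrA mulrC mulrzA -pmulrn ck1 mul0rz.
Qed.

Section PrimaryPart.
Variables (G : zmodType) (p : nat).
Hypotheses (p_pr : prime p) (gbG : generalized_bassian G).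

Local Notation V := (@socle_of_multiples G p).

Lemma poly_comb_independent (c : nat -> G) (U : zmodClosed G) :
  (forall n z, lincomb c n z \in U -> forall j, (j < n)%N -> c j *~ z j = 0) ->
  forall q : {poly int}, poly_comb c q \in U -> forall i, c i *~ q`_i = 0.
Proof.
move=> ind_c q /ind_c cq i; have [/cq//|iq] := ltnP i (size q).
by rewrite nth_default // mulr0z.
Qed.

(** If all socles are infinite, the i-th cyclic summand can be chosen of order
    large enough to map onto the subgroup generated by the i-th element of an
    enumeration of Q[X] modulo p-integral polynomials. *)
Lemma some_socle_finite : exists n, finite_set (V n).
Proof.
apply: contrapT => nfin.
have infV n : ~ finite_set (V n) by move=> fin; apply: nfin; exists n.
have /boolp.choice[k kP] := fun i => p_integral_denominator p_pr (enum_rat_poly i).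
have [||c [ck ck1 ind_c]] := @socle_sequence G p p_pr (trivial_subgroup G) k.
- by apply: (@sub_finite_set _ _ [set 0]) => // x [/in_subgroup_of ->].
- by move=> i.
have co i z := order_eq0 z p_pr (ck i) (ck1 i).
have : forall x, x \in p_integral_rat p.
  apply: (@divisible_image_trivial G c (fun i => (p ^ (k i).+1)%:R^-1)) => //.
  - move=> q cq; apply: (poly_comb_independent ind_c).
    by rewrite cq rpred0.
  - by move=> i z; rewrite co p_integral_int.
  - move=> i z /co /dvdnP[q qE] j.
    have -> : z = (p ^ k i)%:Z * (p%:Z * (sgz z * q%:Z)).
      by rewrite {1}[z]intEsg qE expnSr !PoszM; ring.
    by rewrite mulrzA -pmulrn rpredMz.
move=> /(_ ((p ^ 1)%:R^-1 *~ 1)) /(p_integral_int p_pr).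
by rewrite expn1 dvdn1 => /eqP p1; have := p_pr; rewrite p1.
Qed.

(** Otherwise G contains a direct sum C of cyclic groups c_i of order
    m = p^(k+1), with C meeting mG trivially, so that C, parametrized by
    {poly int} modulo m, is a retract of G.  On C the map phi is the shift c_i to
    c_(i+1), which is multiplication by X, and it fixes the kernel of the
    retraction.  Its image misses p^k c_0, which generates a subgroup N of order p.
    As k > 0, N consists of multiples of p and cannot be a summand. *)
Lemma socle_finite_pred k : (0 < k)%N -> finite_set (V k.+1) -> finite_set (V k).
Proof.
move=> k0 finV; apply: contrapT => infV.
set m := (p ^ k.+1)%N in finV *.
have m0 : (0 < m)%N by rewrite expn_gt0 prime_gt0.
have U0 : exists g : G, 0 = g *+ m by exists 0; rewrite mul0rn.
have UB (x y : G) : (exists g, x = g *+ m) -> (exists g, y = g *+ m) ->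
    exists g, x - y = g *+ m.
  by move=> [g ->] [h ->]; exists (g - h); rewrite mulrnBl.
pose U := subgroup_of U0 UB.
have [||c [ck ck1 ind_c]] := @socle_sequence G p p_pr U (fun=> k).
- by apply: sub_finite_set finV => x [/in_subgroup_of].
- by [].
have co i z := order_eq0 z p_pr (ck i) (ck1 i).
rewrite -/m in ck1.
pose K0 (q : {poly int}) := forall i, (m %| absz (q`_i)%R)%N.
have K00 : K0 0 by move=> i; rewrite coef0 dvdn0.
have K0B q r : K0 q -> K0 r -> K0 (q - r).
  move=> Kq Kr i; have := rpredB (Kq i : q`_i \in dvdz m) (Kr i : r`_i \in dvdz m).
  by rewrite coefB.
pose K := subgroup_of K00 K0B.
have cK (q : {poly int}) : K0 q -> poly_comb c q = 0.
  by move=> Kq; apply: poly_comb_eq0 => i; apply/co.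
(* The retraction onto C must kill mG, as m C = 0.  So A parametrizes C + mG, and
   the map to extend is the projection to C, read in {poly int} modulo m. *)
pose A := ({poly int} * G)%type : zmodType.
have fB : zmod_morphism (fun a : A => poly_comb c a.1 + a.2 *+ m).
  by move=> a b; rewrite raddfB mulrnBl opprD addrACA.
have hB : zmod_morphism (fun a : A => quot_proj K a.1).
  by move=> a b; rewrite raddfB.
have [||h hP] := @torsion_extension A G _ (additive_of fB) (additive_of hB).
- move=> [q x] /= /eqP; rewrite addr_eq0 => /eqP cqx.
  apply/quot_proj_eq0/in_subgroup_of => i; apply/co.
  apply: (poly_comb_independent ind_c); rewrite cqx rpredN.
  by apply/in_subgroup_of; exists x.
- move=> x; exists m, ((0, x) : A); split=> //=; rewrite ?raddf0 ?add0r //.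
  move=> g l mE d; have [q <-] := quot_proj_onto d.
  rewrite -raddfMn => /quot_proj_eq0/in_subgroup_of Kq.
  have l0 : (0 < l)%N by move: m0; rewrite mE; case: (l); rewrite ?muln0.
  exists (quot_proj K (\poly_(i < size q) ((q`_i)%R %/ g)%Z)).
  rewrite -raddfMn; congr (quot_proj K _); apply/polyP => i.
  rewrite coefMn coef_poly; case: ltnP => iq; last by rewrite nth_default // mul0rn.
  have := Kq i; rewrite coefMn pmulrn mulrzz abszM absz_nat mE dvdn_pmul2r // => gq.
  by rewrite pmulrn mulrzz divzK.
have hc q : h (poly_comb c q) = quot_proj K q.
  by have := hP (q, 0); rewrite /= mul0rn addr0.
pose R g y := exists q : {poly int},
  h g = quot_proj K q /\ y = g + poly_comb c (q * 'X - q).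
have hR : partial_hom R.
  split.
  - by exists 0; rewrite mul0r subrr !raddf0 addr0.
  - move=> x y d e [q [hx ->]] [r [hy ->]]; exists (q - r).
    split; first by rewrite !raddfB hx hy.
    rewrite (_ : (q - r) * 'X - (q - r) = (q * 'X - q) - (r * 'X - r)); last by ring.
    by rewrite [in RHS]raddfB opprD addrACA.
  - move=> d [q [h0 ->]].
    have /in_subgroup_of Kq : q \in K by apply/quot_proj_eq0; rewrite -h0 raddf0.
    rewrite add0r; apply: cK; apply: (K0B _ _ _ Kq) => -[|i].
      by rewrite coefMX dvdn0.
    by rewrite coefMX; exact: Kq.
have [g|phi phiP] := partial_hom_total hR.
  by have [q qE] := quot_proj_onto (h g); eexists; exists q.
pose x0 := c 0%N *+ p ^ k.
have N0 : exists z : int, 0 = x0 *~ z by exists 0.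
have NB (x y : G) : (exists z : int, x = x0 *~ z) -> (exists z : int, y = x0 *~ z) ->
    exists z : int, x - y = x0 *~ z.
  by move=> [a ->] [b ->]; exists (a - b); rewrite mulrzBr.
pose N := subgroup_of N0 NB.
have [|M [NM1 NM2]] := @gbG N.
  have eB : zmod_morphism (fun g => quot_proj N (phi g)) by move=> x y; rewrite !raddfB.
  exists (additive_of eB); apply: raddf_inj => g /= /quot_proj_eq0/in_subgroup_of[z phig].
  have [q qE] := quot_proj_onto (h g).
  have phigE : phi g = g + poly_comb c (q * 'X - q) by apply: phiP; exists q.
  (* If phi g = z p^k c_0, then g = z p^k c_0 - (shift - 1)(q) lies in C, so q and b
     agree modulo m; the coefficients of q X = q - b + z p^k then vanish modulo m
     in positive degree. *)
  pose b := (z * (p ^ k)%:Z)%:P - (q * 'X - q).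
  have gE : g = poly_comb c b.
    rewrite /b raddfB /= poly_combC mulrC mulrzA -pmulrn -phig phigE.
    by rewrite addrK.
  have /in_subgroup_of Kqb : q - b \in K.
    by apply/quot_proj_eq0; rewrite raddfB qE gE hc subrr.
  have Kq : K0 q.
    move=> i; have := Kqb i.+1; rewrite !coefB coefC coefMX /= sub0r opprK.
    by rewrite addrC subrK.
  rewrite gE; have := cK _ Kqb; rewrite raddfB /= (cK _ Kq) sub0r => /eqP.
  by rewrite oppr_eq0 => /eqP.
have [n [y [/in_subgroup_of[a nE] My c0E]]] := NM1 (c 0%N).
apply: (ck 0%N); apply: NM2; first by apply/in_subgroup_of; exists 1.
have pkk : (p ^ k.+1 %| p ^ k * p ^ k)%N by rewrite -expnD dvdn_exp2l // -addn1 leq_add2l.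
rewrite c0E mulrnDl nE (_ : x0 *~ a *+ p ^ k = 0) ?add0r ?rpredMn //.
rewrite pmulrn -mulrzA mulrC mulrzA -pmulrn /x0 -mulrnA.
by have /dvdnP[l ->] := pkk; rewrite mulnC mulrnA ck1 mul0rn mul0rz.
Qed.

End PrimaryPart.

(** * Finiteness of the multiples of a primary component *)

Section Primary.
Variables (G : zmodType) (p : nat).

Lemma primary_le (x : G) e k : (e <= k)%N -> x *+ p ^ e = 0 -> x *+ p ^ k = 0.
Proof. by move=> ek xe; rewrite -(subnKC ek) expnD mulrnA xe mul0rn. Qed.

Lemma primary0 : in_primary_component p (0 : G).
Proof. by exists 0%N; rewrite mul0rn. Qed.

Lemma primaryB (x y : G) : in_primary_component p x -> in_primary_component p y ->
  in_primary_component p (x - y).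
Proof.
move=> [e xe] [k yk]; exists (e + k)%N.
rewrite mulrnBl (primary_le _ xe) ?leq_addr // (primary_le _ yk) ?leq_addl //.
by rewrite subr0.
Qed.

Lemma primaryMn (x : G) n : in_primary_component p x -> in_primary_component p (x *+ n).
Proof. by move=> [e xe]; exists e; rewrite mulrnAC xe mul0rn. Qed.

Lemma primary_root (x : G) n : in_primary_component p (x *+ p ^ n) -> in_primary_component p x.
Proof. by move=> [e xe]; exists (n + e)%N; rewrite expnD mulrnA. Qed.

Lemma coprime_divides_primary (x : G) e n : coprime n p -> x *+ p ^ e = 0 ->
  exists u : int, x = x *~ u *+ n.
Proof.
move=> np xe; have [u [v uv]] := bezout_int n (p ^ e).
exists u; rewrite -[LHS]mulr1n [LHS]pmulrn -(eqP (coprimeXr e np)) -uv.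
rewrite mulrzDr mulrzA [v * _]mulrC mulrzA -!pmulrn xe mul0rz addr0.
by rewrite pmulrn.
Qed.

Lemma p_divisible_divisible : prime p ->
  (forall x : G, in_primary_component p x) ->
  (forall x : G, exists y, x = y *+ p) -> divisible G.
Proof.
move=> p_pr primG divp x n n0.
have divpk k (z : G) : exists y, z = y *+ p ^ k.
  elim: k z => [|k IH] z; first by exists z.
  have [y ->] := divp z; have [t ->] := IH y.
  by exists t; rewrite -mulrnA -expnSr.
have [m pm nE] := pfactor_coprime p_pr n0.
have [y yE] := divpk (logn p n) x; have [e ye] := primG y.
rewrite coprime_sym in pm; have [u yu] := coprime_divides_primary pm ye.
by exists (y *~ u); rewrite nE mulrnA -yu -yE.
Qed.

End Primary.

Section PrimaryFinite.
Variables (G : zmodType) (p : nat).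
Hypotheses (p_pr : prime p) (gbG : generalized_bassian G).

Local Notation V := (@socle_of_multiples G p).

Lemma socle_of_multiples_le n k : (n <= k)%N -> V k `<=` V n.
Proof.
move=> nk x [[g ->] xp]; split=> //; exists (g *+ p ^ (k - n)).
by rewrite -mulrnA -expnD subnK.
Qed.

(** A decreasing sequence of finite sets is eventually constant. *)
Lemma socle_stable : finite_set (V 1%N) -> exists2 m, (0 < m)%N & forall n, V m `<=` V n.
Proof.
move=> /finite_seqP[s sE].
have /boolp.choice[k kP] : forall v, exists k, (exists n, ~ V n v) -> ~ V k v.
  by move=> v; have [[k Vk]|] := pselect (exists n, ~ V n v); [exists k|exists 0%N].
exists (\sum_(v <- s) k v).+1 => // n v Vv.
apply: contrapT => nVv.
have vs : v \in s.
  by have : V 1%N v; [exact: socle_of_multiples_le Vv | rewrite sE].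
apply: (kP v); first by exists n.
apply: socle_of_multiples_le Vv; rewrite leqW //.
by rewrite (big_rem v vs) leq_addr.
Qed.

(** If the socle of H = p^m T_p consists of elements of infinite height, then H is
    divisible: subtracting a multiple of p that agrees with x after multiplication
    by p^(e-1) lowers the order p^e of x.  Then [divisible_section], with theta
    multiplication by p and iota the identity, gives a subgroup M of H
    that meets the socle trivially and with p M = H.  As p M is inside M, the
    socle is inside M, so it is zero, and H = 0. *)
Lemma stable_socle_bounds m : (forall n, V m `<=` V n) ->
  forall x : G, in_primary_component p x -> x *+ p ^ m = 0.
Proof.
move=> Vm.
pose P x := exists g : G, in_primary_component p g /\ x = g *+ p ^ m.
have P0 : P 0 by exists 0; split; [exact: primary0|rewrite mul0rn].
have PB x y : P x -> P y -> P (x - y).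
  move=> [g [gp ->]] [h [hp ->]]; exists (g - h); split; first exact: primaryB.
  by rewrite mulrnBl.
pose H := subgroup_of P0 PB.
have Pdiv e x : P x -> x *+ p ^ e = 0 -> exists y, P y /\ x = y *+ p.
  elim: e x => [|e IH] x Px xe.
    by exists 0; split=> //; rewrite mul0rn -xe mulr1n.
  have [g [gp xg]] := Px.
  have [[h hE] hp] : V (m + e.+1) (x *+ p ^ e).
    apply: Vm; split; last by rewrite -mulrnA -expnSr.
    by exists (g *+ p ^ e); rewrite xg mulrnAC.
  have Ph : P (h *+ p ^ m).
    exists h; split=> //; apply: (primary_root (n := m + e.+1)).
    by rewrite -hE; exists 1%N.
  have [||y [Py yE]] := IH (x - h *+ p ^ m *+ p).
  - apply: (PB _ _ Px); have [t [tp ->]] := Ph; exists (t *+ p).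
    by split; [apply: primaryMn|rewrite mulrnAC].
  - by rewrite mulrnBl hE -!mulrnA -expnS -expnD subrr.
  exists (y + h *+ p ^ m); split; last by rewrite mulrnDl -yE subrK.
  rewrite -[h *+ _]opprK; apply: (PB _ _ Py); rewrite -sub0r.
  exact: (PB _ _ P0 Ph).
pose D := subgroup_type H.
have primD (d : D) : in_primary_component p d.
  have /in_subgroup_of[g [gp gE]] := subgroup_valP d.
  have [e ge] : in_primary_component p (subgroup_incl H d).
    by rewrite -[subgroup_incl H d]/(subgroup_val d) gE; apply: primaryMn.
  by exists e; apply: val_inj; rewrite -[LHS]/(subgroup_incl H _) raddfMn ge.
have divpD (d : D) : exists d', d = d' *+ p.
  have [e de] := primD d.
  have [||y [Py yE]] := Pdiv e (subgroup_incl H d).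
  - by have /in_subgroup_of := subgroup_valP d.
  - by rewrite -raddfMn de raddf0.
  have Hy : y \in H by apply/in_subgroup_of.
  exists (SubgroupElt Hy); apply: val_inj.
  by rewrite -[RHS]/(subgroup_incl H _) raddfMn.
have divD := p_divisible_divisible p_pr primD divpD.
have inclH0 (a : D) : subgroup_incl H a = 0 -> a = 0.
  by move=> a0; apply: val_inj; exact: a0.
have [|||M [M_onto M_inj]] := @divisible_section D G D (subgroup_incl H)
  (mulrn_hom D p) (mulrn_hom D 1) gbG divD.
- by move=> d; have [d' ->] := divpD d; exists d'.
- by move=> a /inclH0->; rewrite /= mul0rn.
- move=> a; split=> [/inclH0->|]; first by rewrite /= mul0rn.
  by rewrite -[mulrn_hom D 1 a]/(a *+ 1) mulr1n => ->; rewrite raddf0.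
have noD1 (d : D) : d *+ p = 0 -> d = 0.
  move=> dp; have [a [Ma /= ad]] := M_onto d.
  by apply/inclH0/M_inj => //; rewrite -ad raddfMn rpredMn.
have noD e (d : D) : d *+ p ^ e = 0 -> d = 0.
  elim: e d => [|e IH] d; first by rewrite mulr1n.
  by rewrite expnS mulrnA => /IH/noD1.
move=> x xp; have Hx : x *+ p ^ m \in H by apply/in_subgroup_of; exists x.
have [e de] := primD (SubgroupElt Hx).
by rewrite -[LHS]/(subgroup_incl H (SubgroupElt Hx)) (noD e _ de) raddf0.
Qed.

(** T_p has bounded exponent and the socle of p T_p is finite, so p^j T_p is finite
    for all j > 0 by descending induction on j. *)
Lemma primary_multiples_finite :
  finite_set [set y | exists x : G, in_primary_component p x /\ y = x *+ p].
Proof.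
have finV1 : finite_set (V 1%N).
  have [[|n]] := some_socle_finite p_pr gbG.
    by apply: sub_finite_set; exact: socle_of_multiples_le.
  elim: n => // n IH /(socle_finite_pred p_pr gbG) H; exact: IH (H isT).
have [m m0 /stable_socle_bounds bndm] := socle_stable finV1.
pose W j := [set y | exists x : G, in_primary_component p x /\ y = x *+ p ^ j].
suff finW d j : (m <= j + d)%N -> (0 < j)%N -> finite_set (W j).
  by have := finW m 1%N; rewrite /W expn1; apply; rewrite // leq_addl.
elim: d j => [|d IH] j mj j0.
  apply: (@sub_finite_set _ _ [set 0]) => // y [x [/bndm xm ->]] /=.
  by rewrite addn0 in mj; apply: primary_le xm.
have WB x y : W j x -> W j y -> W j (x - y).
  move=> [g [gp ->]] [h [hp ->]]; exists (g - h); split; first exact: primaryB.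
  by rewrite mulrnBl.
apply: (finite_image_kernel (f := mulrn_hom G p) WB).
  apply: sub_finite_set (IH j.+1 _ isT); last by rewrite addSnnS.
  by move=> _ [_ [x [xp ->]] <-]; exists x; rewrite /= -mulrnA -expnSr.
apply: sub_finite_set finV1 => x [[g [_ xg]] xp].
by apply: (socle_of_multiples_le j0); split=> //; exists g.
Qed.

End PrimaryFinite.

(** * Groups satisfying the finiteness condition *)

Definition finite_primary_multiples (G : zmodType) : Prop := forall p, prime p ->
  finite_set [set y | exists x : G, in_primary_component p x /\ y = x *+ p].

(** As v is injective and v(Y) is contained in u(Y), the set u(Y) has at least as
    many elements as Y. *)
Lemma finite_inj_of_onto (T : eqType) (H : Type) (Y : set T) (u v : T -> H) :
  finite_set Y -> (forall x y, Y x -> Y y -> v x = v y -> x = y) ->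
  (forall x, Y x -> exists2 y, Y y & v x = u y) ->
  forall x y, Y x -> Y y -> u x = u y -> x = y.
Proof.
move=> /finite_seqP[s0 ->] vinj vu x y.
have {vu} /boolp.choice[w wP] : forall x, exists y, x \in s0 -> y \in s0 /\ v x = u y.
  move=> z; have [/vu[t ts vt]|nz] := boolP (z \in s0); first by exists t.
  by exists z => zs; case/negP: nz.
pose s := undup s0.
have ws : {subset map w s <= s}.
  by move=> t /mapP[z]; rewrite !mem_undup => /wP[zs _] ->.
have w_uniq : uniq (map w s).
  rewrite map_inj_in_uniq ?undup_uniq // => z t; rewrite !mem_undup => zs ts wzt.
  apply: vinj => //.
  by rewrite (wP z zs).2 (wP t ts).2 wzt.
have [_ wE] := uniq_min_size w_uniq ws (eq_leq (esym (size_map w s))).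
move=> /= xs ys uxy.
have: x \in map w s by rewrite wE mem_undup.
have: y \in map w s by rewrite wE mem_undup.
case/mapP => b; rewrite mem_undup => bs yE; case/mapP => a; rewrite mem_undup => as_ xE.
suff -> : x = y by [].
rewrite xE yE; congr w; apply: vinj => //.
by rewrite (wP a as_).2 (wP b bs).2 -xE -yE.
Qed.

(** An element of N of infinite order could be added to lifts of the images of a
    maximal independent family, giving a larger independent family of G. *)
Lemma kernel_of_embedding_torsion (G : zmodType) (N : zmodClosed G)
    (phi : {additive G -> Quotient.quot N}) :
  finite_rank G -> injective phi ->
  forall x, x \in N -> exists2 m, (0 < m)%N & x *+ m = 0.
Proof.
move=> /finite_rank_span[r [c [ind_c span_c]]] phi_inj x Nx.
apply: contrapT => xtf.
have /boolp.choice[g gE] : forall i, exists g, quot_proj N g = phi (c i).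
  by move=> i; exact: quot_proj_onto.
pose d j := if (j < r)%N then g j else x.
have := rank_le_span span_c; move=> /(_ r.+1 d); rewrite ltnn => H.
suff: false by []; apply: H => z.
have dE : lincomb d r z = lincomb g r z.
  by apply: eq_lincomb => j jr; rewrite /d jr.
rewrite lincombS dE {1}/d ltnn => gz.
have gzN : lincomb g r z \in N.
  by rewrite -[lincomb _ _ _](addrK (x *~ z r)) gz sub0r rpredN rpredMz.
have z0 : forall j, (j < r)%N -> z j = 0.
  apply: ind_c; apply: phi_inj; rewrite raddf0 raddf_lincomb.
  rewrite (eq_lincomb (c' := quot_proj N \o g) (z' := z)) => [|j _ /=]; last by rewrite gE.
  by rewrite -raddf_lincomb; apply/quot_proj_eq0.
have zr : z r = 0.
  apply/eqP/negPn/negP => zr0; apply: xtf; exists `|z r|%N; first by rewrite absz_gt0.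
  rewrite pmulrn abszEsg mulrC mulrzA; have -> : x *~ z r = 0; last by rewrite mul0rz.
  rewrite -gz /lincomb big1 ?add0r // => j _.
  by rewrite z0 ?mulr0z.
by move=> j; rewrite ltnS leq_eqVlt => /orP[/eqP->|/z0].
Qed.

(** On the finite group Y of the elements of T_p in L, psi is injective with values in
    the image of Y, so that [finite_inj_of_onto] makes the projection to G/N
    injective on Y.  To see that psi(Y) is contained in the image of Y, a preimage
    in L of an element of p-power order is corrected by an element of N, using
    that N is torsion. *)
Lemma primary_trivial_intersection (G : zmodType) (N L : zmodClosed G) p
    (psi : {additive G -> Quotient.quot N}) :
  prime p ->
  (forall x, x \in N -> exists2 m, (0 < m)%N & x *+ m = 0) ->
  (forall x, in_primary_component p x -> psi x = 0 -> x = 0) ->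
  (forall x, x \in L -> exists2 y, y \in L & psi x = quot_proj N y) ->
  finite_set [set x | in_primary_component p x /\ x \in L] ->
  forall x, x \in N -> in_primary_component p x -> x \in L -> x = 0.
Proof.
move=> p_pr torN psi_inj psiL finL x Nx px Lx.
apply: (finite_inj_of_onto (u := quot_proj N) (v := psi) finL) => //; first 1 last.
- move=> t [[e te] Lt]; have [y Ly psit] := psiL t Lt.
  have Ny : y *+ p ^ e \in N.
    by apply/quot_proj_eq0; rewrite raddfMn -psit -raddfMn te raddf0.
  have [n n0 yn] := torN _ Ny.
  have [m pm nE] := pfactor_coprime p_pr n0.
  rewrite coprime_sym in pm.
  have [u [v uv]] := bezout_int m (p ^ (e + logn p n)).
  rewrite (eqP (coprimeXr _ pm)) in uv.
  (* Both y and u m y have the same class modulo N, and u m y is in T_p. *)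
  have yE : y *~ (u * m%:Z) = y - y *+ p ^ e *~ ((p ^ logn p n)%:Z * v).
    rewrite pmulrn -mulrzA mulrA -PoszM -expnD [_ * v]mulrC.
    by apply/eqP; rewrite eq_sym subr_eq -mulrzDr uv.
  exists (y *~ (u * m%:Z)).
    split; last exact: rpredMz.
    exists (e + logn p n)%N; rewrite pmulrn -mulrzA -mulrA [u * _]mulrC mulrzA.
    rewrite -PoszM -pmulrn expnD [(m * _)%N]mulnC -mulnA [(_ * m)%N]mulnC -nE.
    by rewrite mulrnA yn mul0rz.
  rewrite yE raddfB psit; have /quot_proj_eq0 -> : y *+ p ^ e *~ ((p ^ logn p n)%:Z * v) \in N.
    exact: rpredMz.
  by rewrite subr0.
- by split; [exact: primary0 | exact: rpred0].
- by rewrite raddf0; apply/quot_proj_eq0.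
- move=> y z [py _] [pz _] yz; apply/eqP; rewrite -subr_eq0; apply/eqP.
  by apply: psi_inj; [exact: primaryB | rewrite raddfB yz subrr].
Qed.

(** A nonzero torsion element has a multiple of prime order. *)
Lemma torsion_trivial (G : zmodType) (S : zmodClosed G) :
  (forall x, x \in S -> exists2 m, (0 < m)%N & x *+ m = 0) ->
  (forall p x, prime p -> x \in S -> x *+ p = 0 -> x = 0) ->
  forall x, x \in S -> x = 0.
Proof.
move=> torS Sp x Sx; have [m m0 xm] := torS x Sx.
elim/ltn_ind: m m0 xm => m IH m0 xm.
have [m1|m1] := leqP m 1.
  by have m1' : m = 1%N by [case: m m0 m1 {IH xm} => [|[]]]; rewrite -[x]mulr1n -m1' xm.
have p_pr := pdiv_prime m1; have mE := divnK (pdiv_dvd m).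
apply: (IH (m %/ pdiv m)%N).
- by rewrite ltn_Pdiv ?prime_gt1.
- by rewrite divn_gt0 ?prime_gt0 // dvdn_leq // pdiv_dvd.
- by apply: (Sp (pdiv m)); rewrite ?rpredMn // -mulrnA mE.
Qed.

Section Local.
Variables (G : zmodType) (L : nat -> zmodClosed G).
Hypotheses (pL : forall p x, prime p -> x *+ p \in L p)
  (torL : forall x, exists2 m, (0 < m)%N & forall p, prime p -> x *+ m \in L p).

Lemma mem_local p q x : prime p -> coprime q p -> x *+ q \in L p -> x \in L p.
Proof.
move=> p_pr qp Lx; have [u [v uv]] := bezout_int q p.
rewrite (eqP qp) in uv; rewrite -[x]mulr1n pmulrn -uv mulrzDr.
rewrite [u * _]mulrC [v * _]mulrC !mulrzA -!pmulrn.
by rewrite rpredD ?rpredMz ?pL.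
Qed.

(** The least such m: if q^2 divided m, then m / q would do, at q because qG is
    contained in L q, and at the other primes p because q is invertible modulo p. *)
Lemma square_free_multiple x :
  exists m, [/\ (0 < m)%N, square_free m & forall p, prime p -> x *+ m \in L p].
Proof.
pose S m := `[< (0 < m)%N /\ forall p, prime p -> x *+ m \in L p >].
have exS : exists m, S m.
  by have [m m0 Lm] := torL x; exists m; apply/asboolP.
case: (ex_minnP exS) => m /asboolP[m0 Lm] minm; exists m; split=> // q q_pr.
apply/negP => /dvdnP[k mE]; have q0 := prime_gt0 q_pr.
have : S (k * q)%N.
  apply/asboolP; split=> [|p p_pr].
    by move: m0; rewrite mE mulnA muln_gt0 => /andP[].
  have [->|qp] := eqVneq p q; first by rewrite mulrnA pL.
  apply: (@mem_local p q) => //.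
    by rewrite prime_coprime // dvdn_prime2 // eq_sym.
  by rewrite -mulrnA -mulnA -mE Lm.
move=> /minm; rewrite {1}mE mulnA -{2}[(k * q)%N]muln1 leq_pmul2l.
  by rewrite leqNgt prime_gt1.
by move: m0; rewrite mE mulnA muln_gt0 => /andP[].
Qed.

(** [square_free_summand] applies to the intersection C of the L p over all primes p:
    a nonzero element of N and C would have a multiple of some prime order p, in L p. *)
Lemma local_summand (N : zmodClosed G) :
  (forall x, x \in N -> exists2 m, (0 < m)%N & x *+ m = 0) ->
  (forall p x, prime p -> x \in N -> x *+ p = 0 -> x \in L p -> x = 0) ->
  direct_summand N.
Proof.
move=> torN NL; pose C0 x := forall p, prime p -> x \in L p.
have C00 : C0 0 by move=> p _; exact: rpred0.
have C0B x y : C0 x -> C0 y -> C0 (x - y).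
  by move=> Cx Cy p p_pr; rewrite rpredB ?Cx ?Cy.
pose C := subgroup_of C00 C0B.
apply: (@square_free_summand _ N C); last first.
  move=> x; have [m [m0 sfm Lm]] := square_free_multiple x.
  by exists m; split=> //; apply/in_subgroup_of.
pose NC0 x := x \in N /\ x \in C.
have NC00 : NC0 0 by split; exact: rpred0.
have NC0B x y : NC0 x -> NC0 y -> NC0 (x - y).
  by move=> [Nx Cx] [Ny Cy]; split; apply: rpredB.
move=> x Nx Cx; apply: (torsion_trivial (S := subgroup_of NC00 NC0B)).
- by move=> y /in_subgroup_of[/torN].
- move=> p y p_pr /in_subgroup_of[Ny Cy] yp.
  by apply: (NL p) => //; move/in_subgroup_of: Cy; apply.
- by apply/in_subgroup_of.
Qed.

End Local.

Section Span.
Variables (G : zmodType) (n : nat) (c : nat -> G).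

Lemma span0 : exists z, 0 = lincomb c n z.
Proof. by exists (fun=> 0); rewrite lincomb0. Qed.

Lemma spanB x y : (exists z, x = lincomb c n z) -> (exists z, y = lincomb c n z) ->
  exists z, x - y = lincomb c n z.
Proof. by move=> [z ->] [t ->]; eexists; exact: lincombB. Qed.

Definition span := subgroup_of span0 spanB.

End Span.

Section PlusMultiples.
Variables (G : zmodType) (F : zmodClosed G) (p : nat).

Lemma plus_multiples0 : exists f g : G, f \in F /\ 0 = f + g *+ p.
Proof. by exists 0, 0; rewrite rpred0 mul0rn addr0. Qed.

Lemma plus_multiplesB (x y : G) : (exists f g, f \in F /\ x = f + g *+ p) ->
  (exists f g, f \in F /\ y = f + g *+ p) -> exists f g, f \in F /\ x - y = f + g *+ p.
Proof.
move=> [f [g [Ff ->]]] [f' [g' [Ff' ->]]]; exists (f - f'), (g - g').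
by rewrite rpredB // mulrnBl opprD addrACA.
Qed.

Definition plus_multiples := subgroup_of plus_multiples0 plus_multiplesB.

Lemma mem_plus_multiples f g : f \in F -> f + g *+ p \in plus_multiples.
Proof. by move=> Ff; apply/in_subgroup_of; exists f, g. Qed.

End PlusMultiples.

(** Modulo pG only finitely many classes come from a finitely generated group, and
    the elements of T_p in pG are those of p T_p. *)
Lemma finite_primary_plus_multiples (G : zmodType) p n (c : nat -> G) :
  prime p ->
  finite_set [set y | exists x : G, in_primary_component p x /\ y = x *+ p] ->
  finite_set [set x | in_primary_component p x /\ x \in plus_multiples (span n c) p].
Proof.
move=> p_pr finp.
pose P := plus_multiples (trivial_subgroup G) p.
have Pp x : x *+ p \in P by rewrite -[_ *+ p]add0r mem_plus_multiples ?rpred0.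
apply: (finite_image_kernel (f := quot_proj P)).
- move=> x y [px Lx] [py Ly]; split; first exact: primaryB.
  exact: rpredB.
- apply: (@sub_finite_set _ _ [set y | exists z, y = lincomb (quot_proj P \o c) n z]).
    move=> _ [x [_ /in_subgroup_of[f [g [/in_subgroup_of[z ->] ->]]]] <-]; exists z.
    rewrite raddfD raddf_lincomb; have /quot_proj_eq0 -> := Pp g.
    by rewrite addr0.
  apply: (finite_lincomb (prime_gt0 p_pr)) => j _ /=.
  by rewrite -raddfMn; apply/quot_proj_eq0.
- apply: sub_finite_set finp => x [[[e xe] _]] /quot_proj_eq0/in_subgroup_of.
  case=> f [g [/in_subgroup_of -> xE]]; exists g; rewrite add0r in xE; split=> //.
  by exists e.+1; rewrite expnS mulrnA -xE.
Qed.

(** Here K phi(F) is contained in the image of F.  For p not dividing K,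
    multiplication by K is injective on T_p and K phi is used with F + pG; for p
    dividing K, phi itself is used with pG. *)
Theorem generalized_bassian_of_finite (G : zmodType) :
  finite_rank G -> finite_primary_multiples G -> generalized_bassian G.
Proof.
move=> rkG finG N [phi phi_inj].
have torN := kernel_of_embedding_torsion rkG phi_inj.
have [n [c [_ span_c]]] := finite_rank_span rkG.
have /boolp.choice[g gE] : forall i, exists g, quot_proj N g = phi (c i).
  by move=> i; exact: quot_proj_onto.
have /boolp.choice[k kP] : forall i, exists k, (0 < k)%N /\ g i *+ k \in span n c.
  move=> i; have [k [z [k0 kE]]] := span_c (g i); exists k; split=> //.
  by apply/in_subgroup_of; exists z.
pose K := (\prod_(i < n) k i)%N.
have K0 : (0 < K)%N by rewrite prodn_gt0 // => i; have [] := kP i.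
have gK i : (i < n)%N -> g i *+ K \in span n c.
  by move=> lin; rewrite /K (bigD1 (Ordinal lin)) // mulrnA rpredMn //; have [] := kP i.
have FK f : f \in span n c -> exists2 f', f' \in span n c & phi f *+ K = quot_proj N f'.
  move=> /in_subgroup_of[z ->]; exists (lincomb g n z *+ K).
    rewrite /lincomb -sumrMnl rpred_sum // => i _.
    by rewrite pmulrn mulrzAC rpredMz // -pmulrn gK.
  rewrite raddfMn !raddf_lincomb; congr (_ *+ K).
  by apply: eq_lincomb => j _ /=; rewrite gE.
pose F p := if (p %| K)%N then trivial_subgroup G else span n c.
pose kap p := if (p %| K)%N then 1%N else K.
have Fkap p f : f \in F p -> exists2 f', f' \in F p & phi f *+ kap p = quot_proj N f'.
  rewrite /F /kap; case: ifP => _; last exact: FK.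
  by move=> /in_subgroup_of ->; exists 0; rewrite ?rpred0 // !raddf0.
have kap_cop p : prime p -> coprime (kap p) p.
  move=> p_pr; rewrite /kap; case: ifP => [_|/negbT nK]; first exact: coprime1n.
  by rewrite coprime_sym prime_coprime.
have finL p : prime p -> finite_set
    [set x | in_primary_component p x /\ x \in plus_multiples (F p) p].
  move=> p_pr; apply: sub_finite_set (finite_primary_plus_multiples n c p_pr (finG p p_pr)).
  move=> x [px Lx]; split=> //; have /in_subgroup_of[f [h [Ff ->]]] := Lx.
  apply: mem_plus_multiples.
  move: Ff; rewrite /F; case: ifP => // _ /in_subgroup_of ->.
  exact: rpred0.
apply: (@local_summand _ (fun p => plus_multiples (F p) p)) => //.
- by move=> p x _; rewrite -[x *+ p]add0r mem_plus_multiples ?rpred0.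
- move=> x; have [m [z [m0 xm]]] := span_c x.
  exists (m * K)%N; first by rewrite muln_gt0 m0.
  move=> p p_pr; have [pK|pK] := boolP (p %| K)%N.
    have /dvdnP[q ->] := pK; rewrite mulnA mulrnA -[_ *+ p]add0r.
    by rewrite mem_plus_multiples ?rpred0.
  rewrite -[x *+ _]addr0 -[X in _ + X](mul0rn _ p) mem_plus_multiples //.
  rewrite /F (negPf pK) mulrnA rpredMn //.
  by apply/in_subgroup_of; exists z.
- move=> p x p_pr Nx xp.
  have psiB : zmod_morphism (fun y => phi y *+ kap p).
    by move=> y z; rewrite raddfB mulrnBl.
  apply: (primary_trivial_intersection (psi := additive_of psiB) p_pr torN) => //.
  + move=> y [e ye] /=; rewrite -raddfMn => ky.
    have {}ky : y *+ kap p = 0 by apply: phi_inj; rewrite ky raddf0.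
    have [u ->] := coprime_divides_primary (kap_cop p p_pr) ye.
    by rewrite pmulrn mulrzAC -pmulrn ky mul0rz.
  + move=> y /in_subgroup_of[f [h [Ff ->]]].
    have [f' Ff' fE] := Fkap p f Ff.
    have [h' hE] := quot_proj_onto (phi h *+ kap p).
    exists (f' + h' *+ p); first exact: mem_plus_multiples.
    by rewrite /= !raddfD mulrnDl fE !raddfMn hE mulrnAC.
  + exact: finL.
  + by exists 1%N.
Qed.

(** With T_p itself finite, counting applies to T_p instead of T_p meeting F + pG. *)
Theorem bassian_of_finite (G : zmodType) : finite_rank G ->
  (forall p, prime p -> finite_set [set x : G | in_primary_component p x]) ->
  bassian G.
Proof.
move=> rkG finG N [phi phi_inj] x.
have torN := kernel_of_embedding_torsion rkG phi_inj.
apply/idP/eqP => [|->]; last exact: rpred0.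
apply: (torsion_trivial torN) => p {}x p_pr Nx xp.
pose L := subgroup_of (P := fun=> True) I (fun (_ _ : G) _ _ => I).
have LT y : y \in L by apply/in_subgroup_of.
apply: (primary_trivial_intersection (L := L) (psi := phi) p_pr torN) => //.
- by move=> y _ py; apply: phi_inj; rewrite py raddf0.
- by move=> y _; have [z <-] := quot_proj_onto (phi y); exists z.
- by apply: sub_finite_set (finG p p_pr) => y [].
- by exists 1%N.
Qed.

(** * Splitting off an elementary summand *)

Lemma square_free_lcmn a b : (0 < a)%N -> (0 < b)%N ->
  square_free a -> square_free b -> square_free (lcmn a b).
Proof.
move=> a0 b0 sfa sfb q q_pr; have := sfa q q_pr; have := sfb q q_pr.
rewrite -[(q * q)%N]/(q ^ 2)%N !pfactor_dvdn ?lcmn_gt0 ?a0 // logn_lcm //.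
by rewrite leq_max negb_or => -> ->.
Qed.

Section SquareFreeTorsion.
Variable G : zmodType.

Definition square_free_torsion (x : G) := exists m,
  [/\ (0 < m)%N, square_free m & x *+ m = 0].

Lemma square_free_torsion0 : square_free_torsion 0.
Proof.
exists 1%N; split=> // q q_pr; apply/negP; rewrite dvdn1 muln_eq1 => /andP[/eqP q1].
by rewrite q1 in q_pr.
Qed.

Lemma square_free_torsionB x y : square_free_torsion x -> square_free_torsion y ->
  square_free_torsion (x - y).
Proof.
move=> [a [a0 sfa xa]] [b [b0 sfb yb]].
exists (lcmn a b); split; first by rewrite lcmn_gt0 a0.
  exact: square_free_lcmn.
have /dvdnP[k kE] := dvdn_lcml a b; have /dvdnP[l lE] := dvdn_lcmr a b.
have xl : x *+ lcmn a b = 0 by rewrite kE mulnC mulrnA xa mul0rn.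
have yl : y *+ lcmn a b = 0 by rewrite lE mulnC mulrnA yb mul0rn.
by rewrite mulrnBl xl yl subrr.
Qed.

Definition square_free_part := subgroup_of square_free_torsion0 square_free_torsionB.

End SquareFreeTorsion.

Lemma square_free_primary (G : zmodType) (x : G) m p k : prime p -> (0 < m)%N ->
  square_free m -> x *+ m = 0 -> x *+ p ^ k = 0 -> x *+ p = 0.
Proof.
move=> p_pr m0 sfm xm xk; have [u [v uv]] := bezout_int m (p ^ k).
have xg : x *+ gcdn m (p ^ k) = 0.
  rewrite pmulrn -uv mulrzDr [u * _]mulrC [v * _]mulrC !mulrzA -!pmulrn xm xk.
  by rewrite !mul0rz addr0.
have /(dvdn_pfactor _ _ p_pr)[e _ gE] := dvdn_gcdr m (p ^ k).
rewrite gE in xg; apply: (primary_le (e := e) (k := 1) _ xg).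
rewrite leqNgt; apply/negP => e2; have := sfm p p_pr; rewrite -[(p * p)%N]/(p ^ 2)%N.
by rewrite (dvdn_trans (dvdn_exp2l p e2)) // -gE dvdn_gcdl.
Qed.

Lemma direct_sumC (G : zmodType) (N M : zmodClosed G) :
  direct_sum N M -> direct_sum M N.
Proof.
move=> [sumNM capNM]; split=> [x|x Mx Nx]; last exact: capNM.
by have [n [m [Nn Mm ->]]] := sumNM x; exists m, n; split=> //; rewrite addrC.
Qed.

(** Inside the subgroup S of the elements of square-free order, the elements that
    lie in all F + pG have a complement E, by [square_free_summand].  E meets each
    F + pG trivially in the p-torsion, so it is a summand of G.  In a complement A of
    E, an element of order p is determined by its component outside E, which lies
    in the finite group of elements of T_p in F + pG; so each A_p is finite. *)
Theorem BE_group_of_finite (G : zmodType) :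
  finite_rank G -> finite_primary_multiples G -> BE_group G.
Proof.
move=> rkG finG; have [n [c [_ span_c]]] := finite_rank_span rkG.
pose L p := plus_multiples (span n c) p.
have pL p (x : G) : x *+ p \in L p.
  by rewrite -[x *+ p]add0r mem_plus_multiples // rpred0.
have torL x : exists2 m, (0 < m)%N & forall p, prime p -> x *+ m \in L p.
  have [m [z [m0 xm]]] := span_c x; exists m => // p _.
  rewrite -[x *+ m]addr0 -[X in _ + X](mul0rn _ p) mem_plus_multiples //.
  by apply/in_subgroup_of; exists z.
pose S := square_free_part G.
have Sprime p x : prime p -> x *+ p = 0 -> x \in S.
  move=> p_pr xp; apply/in_subgroup_of; exists p; split=> //; first exact: prime_gt0.
  move=> q q_pr; apply/negP => qp; have q1 := prime_gt1 q_pr.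
  have /eqP qE : q == p by rewrite -dvdn_prime2 // (dvdn_trans _ qp) // dvdn_mulr.
  move: qp; rewrite qE => /dvdn_leq; rewrite prime_gt0 // => /(_ isT).
  by rewrite -[X in (_ <= X)%N]muln1 leq_pmul2l ?prime_gt0 // leqNgt prime_gt1.
pose C0 (x : G) := forall p, prime p -> x \in L p.
have C00 : C0 0 by move=> p _; exact: rpred0.
have C0B x y : C0 x -> C0 y -> C0 (x - y).
  by move=> Cx Cy p p_pr; rewrite rpredB ?Cx ?Cy.
pose i : {additive subgroup_type S -> G} := subgroup_incl S.
have i_inj x : i x = 0 -> x = 0 by move=> x0; apply: val_inj; exact: x0.
have iS x : square_free_torsion (i x) by have /in_subgroup_of := subgroup_valP x.
have N00 : C0 (i 0) by rewrite raddf0.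
have N0B x y : C0 (i x) -> C0 (i y) -> C0 (i (x - y)) by rewrite raddfB; exact: C0B.
pose N := subgroup_of (P := fun x => C0 (i x)) N00 N0B.
have [||M [NM1 NM2]] := @square_free_summand _ N (trivial_subgroup _).
- by move=> x _ /in_subgroup_of.
- move=> x; have [m [m0 sfm xm]] := iS x; exists m; split=> //.
  by apply/in_subgroup_of/i_inj; rewrite raddfMn.
pose E0 x := exists2 u, u \in M & i u = x.
have E00 : E0 0 by exists 0; rewrite ?rpred0 ?raddf0.
have E0B x y : E0 x -> E0 y -> E0 (x - y).
  by move=> [u Mu <-] [v Mv <-]; exists (u - v); rewrite ?rpredB ?raddfB.
pose E := subgroup_of E00 E0B.
have EL p x : prime p -> x \in E -> x *+ p = 0 -> x \in L p -> x = 0.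
  move=> p_pr /in_subgroup_of[u Mu <-] up Lu.
  suff -> : u = 0 by rewrite raddf0.
  apply: NM2 => //; apply/in_subgroup_of => q q_pr.
  have [->//|qp] := eqVneq q p.
  have pq : coprime p q by rewrite prime_coprime // dvdn_prime2 // eq_sym.
  by apply: (@mem_local _ L (fun p x _ => pL p x) q p); rewrite // up rpred0.
have [|A EA] := local_summand (fun p x _ => pL p x) torL _ EL.
  move=> x /in_subgroup_of[u _ <-]; have [m [m0 _ um]] := iS u; by exists m.
exists A, E; split; first exact: direct_sumC.
- apply: bassian_of_finite.
    have [r rkr] := rkG; exists r.
    apply: (rank_le_torsion_kernel (f := subgroup_incl A)) rkr => x x0.
    by exists 1%N => //; apply: val_inj.
  move=> p p_pr.
  have fB : zmod_morphism (fun a => subgroup_incl A a *+ p).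
    by move=> x y; rewrite raddfB mulrnBl.
  apply: (finite_image_kernel (f := additive_of fB)).
  + by move=> x y; exact: primaryB.
  + apply: sub_finite_set (finG p p_pr) => _ [a [e ae] <-].
    exists (subgroup_incl A a); split=> //; exists e.
    by rewrite -raddfMn ae raddf0.
    (* s y is the element of A congruent to y modulo E, if there is one. *)
  + have /boolp.choice[s sP] : forall y, exists a, (exists b, y - subgroup_incl A b \in E) ->
        y - subgroup_incl A a \in E.
      move=> y; have [[b bE]|nb] := pselect (exists b, y - subgroup_incl A b \in E).
        by exists b.
      by exists 0.
    have finY := finite_primary_plus_multiples n c p_pr (finG p p_pr).
    apply: sub_finite_set (finite_image s finY) => a [_ /= ap].
    have /subgroup_inclP[u uE'] := Sprime p _ p_pr ap.
    have uE : i u = subgroup_incl A a := uE'.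
    have [v [w [/in_subgroup_of Nv Mw uvw]]] := NM1 u.
    have up : u *+ p = 0 by apply: i_inj; rewrite raddfMn uE.
    have vp : v *+ p = 0.
      apply: NM2; first by rewrite rpredMn //; apply/in_subgroup_of.
      have -> : v *+ p = - (w *+ p).
        by apply/eqP; rewrite -addr_eq0 -mulrnDl -uvw up.
      by rewrite rpredN rpredMn.
    exists (i v).
      split; last exact: Nv.
      by exists 1%N; rewrite expn1 -raddfMn vp raddf0.
    have ivE : i v - subgroup_incl A a \in E.
      apply/in_subgroup_of; exists (- w); first by rewrite rpredN.
      have -> : subgroup_incl A a = i v + i w by rewrite -uE uvw raddfD.
      by rewrite raddfN opprD addrA subrr sub0r.
    have /sP isE : exists b, i v - subgroup_incl A b \in E by exists a.
    apply/eqP; rewrite -subr_eq0; apply/eqP; apply: val_inj.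
    apply: EA.2; last exact: subgroup_valP.
    rewrite -[val _]/(subgroup_incl A _) raddfB.
    have -> : subgroup_incl A (s (i v)) - subgroup_incl A a =
        (i v - subgroup_incl A a) - (i v - subgroup_incl A (s (i v))).
      by rewrite opprB [RHS]addrC addrA subrK.
    exact: rpredB.
- have Etor (x : subgroup_type E) : square_free_torsion x.
    have /in_subgroup_of[u _ uE] := subgroup_valP x.
    have [m [m0 sfm um]] := iS u; exists m; split=> //; apply: val_inj.
    by rewrite -[LHS]/(subgroup_incl E _) raddfMn -[subgroup_incl E x]/(subgroup_val x) -uE um.
  split=> [x|p x p_pr [k xk]]; have [m [m0 sfm xm]] := Etor x; first by exists m.
  exact: square_free_primary xm xk.
Qed.

Lemma generalized_bassian_finite (G : zmodType) : generalized_bassian G ->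
  finite_rank G /\ finite_primary_multiples G.
Proof.
move=> gbG; split; first exact: generalized_bassian_finite_rank.
by move=> p p_pr; exact: primary_multiples_finite.
Qed.

Lemma bassian_generalized (G : zmodType) : bassian G -> generalized_bassian G.
Proof.
move=> bG N /bG N0.
exists (subgroup_of (P := fun=> True) I (fun (_ _ : G) _ _ => I)); split.
  move=> x; exists 0, x; split; rewrite ?add0r ?rpred0 //.
  exact/in_subgroup_of.
by move=> x; rewrite N0 => /eqP.
Qed.

Lemma direct_sum_projection (G : zmodType) (A E : zmodClosed G) : direct_sum A E ->
  exists h : {additive G -> subgroup_type A}, forall x, x - subgroup_incl A (h x) \in E.
Proof.
move=> [sumAE capAE].
pose R x (u : subgroup_type A) := x - subgroup_incl A u \in E.
have hR : partial_hom R.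
  split.
  - by rewrite /R sub0r rpredN (raddf0 (subgroup_incl A)) rpred0.
  - move=> x y u v Ru Rv.
    by rewrite /R (raddfB (subgroup_incl A)) opprD addrACA -opprD rpredB.
  - move=> u; rewrite /R sub0r rpredN => Eu; apply: val_inj.
    by apply: capAE => //; exact: subgroup_valP.
have totR x : exists u, R x u.
  have [a [e [/subgroup_inclP[u <-] Ee ->]]] := sumAE x.
  by exists u; rewrite /R addrAC subrr add0r.
have [h hP] := partial_hom_total hR totR.
by exists h => x; have [u Ru] := totR x; rewrite (hP x u Ru).
Qed.

(** G maps onto A with torsion kernel E, and p kills E_p, so rank and p T_p are
    those of A. *)
Lemma BE_group_finite (G : zmodType) : BE_group G ->
  finite_rank G /\ finite_primary_multiples G.
Proof.
move=> [A [E [AE bA [torE elemE]]]].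
have [[n rkA] finA] := generalized_bassian_finite (bassian_generalized bA).
have [h hE] := direct_sum_projection AE; split.
  exists n; apply: (rank_le_torsion_kernel (f := h)) rkA => x hx.
  have := hE x; rewrite hx (raddf0 (subgroup_incl A)) subr0 => /subgroup_inclP[u <-].
  by have [m m0 um] := torE u; exists m; rewrite // -raddfMn um raddf0.
move=> p p_pr; apply: sub_finite_set (finite_image (subgroup_incl A) (finA p p_pr)).
move=> _ [x [[e xe] ->]]; exists (h x *+ p).
  by exists (h x); split=> //; exists e; rewrite -raddfMn xe raddf0.
rewrite raddfMn; apply/eqP; rewrite eq_sym -subr_eq0 -mulrnBl; apply/eqP.
have /subgroup_inclP[u uE] := hE x.
rewrite -uE -raddfMn elemE ?raddf0 //; exists e; apply: val_inj.
rewrite -[LHS]/(subgroup_incl E _) raddfMn uE mulrnBl xe sub0r.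
by rewrite -(raddfMn (subgroup_incl A)) -raddfMn xe !raddf0.
Qed.

Theorem corollary4p4 (G : zmodType) :
  warfield G -> (generalized_bassian G <-> BE_group G).
Proof.
move=> _; split=> [/generalized_bassian_finite|/BE_group_finite] [].
  exact: BE_group_of_finite.
exact: generalized_bassian_of_finite.
Qed.
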